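(* Let $f$ satisfy the assumption (A1) stated in the context, and for $c\ge c^*$ let $E(c)=\min_{\mu\in\mathcal{M}_c}\mu(\mathbb{R})$ be the minimum cost. Then $E(c)$ is an increasing, convex function of the speed $c\in[c^*,+\infty[$.
   Context: Assumption (A1) (monostable): $f\in C^2$, $f(0)=f(1)=0$, and $f''(u)<0$ for all $u\in[0,1]$. Under (A1), $c^*<0$ is the number such that there exists $U:\mathbb{R}\to[0,1]$ with $U''+cU'+f(U)=0$, $U(-\infty)=0$, $U(+\infty)=1$ for every speed $c\le c^*$ and for no speed $c>c^*$. $\mathcal{M}_c$ denotes the set of all positive, bounded Radon measures $\mu$ on $\mathbb{R}$ such that the problem $$U''+cU'+f(U)=\mu,\qquad U(-\infty)=0,\quad U(+\infty)=1$$ has a monotonically increasing (i.e. nondecreasing) solution $U$; the equation is understood in the sense of measures. *)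

(* Defs.v *)
From HB Require Import structures.
From mathcomp Require Import all_boot all_order all_algebra.
From mathcomp Require Import all_classical all_reals all_analysis.

Set Implicit Arguments.
Unset Strict Implicit.
Unset Printing Implicit Defensive.

Import Order.TTheory GRing.Theory Num.Theory.
Import numFieldNormedType.Exports.

Local Open Scope classical_set_scope.
Local Open Scope ring_scope.

Definition C2 (R : realType) (f : R -> R) : Prop :=
  [/\ forall x, derivable f x 1, forall x, derivable f^`()%classic x 1
    & continuous (f^`(2)%classic : R -> R)].

Definition monostable (R : realType) (f : R -> R) : Prop :=
  [/\ C2 f, f 0 = 0, f 1 = 0 & forall u, 0 <= u <= 1 -> f^`(2)%classic u < 0].

Definition from0to1 (R : realType) (U : R -> R) : Prop :=
  (U x @[x --> -oo] --> (0 : R)) /\ (U x @[x --> +oo] --> (1 : R)).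

Definition traveling_wave (R : realType) (f : R -> R) (c : R) (U : R -> R) :
    Prop :=
  [/\ forall x, 0 <= U x <= 1,
      forall x, derivable U x 1,
      forall x, derivable U^`()%classic x 1,
      forall x, U^`(2)%classic x + c * U^`()%classic x + f (U x) = 0
    & from0to1 U].

Definition critical_speed (R : realType) (f : R -> R) (cs : R) : Prop :=
  [/\ cs < 0,
      forall c, c <= cs -> exists U, traveling_wave f c U
    & forall c, cs < c -> ~ exists U, traveling_wave f c U].

(* U'' is a Radon measure iff U' has a right-continuous representative V of
   locally bounded variation, i.e. V = g - h with g and h nondecreasing and
   right-continuous; then U'' is the difference of the Stieltjes measures of g
   and h.  As a difference of locally finite measures it is only defined on
   bounded Borel sets (where every measure below is finite), and a Radon
   measure is determined by its values there. *)
Definition measure_solution (R : realType) (f : R -> R) (c : R)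
    (mu : {finite_measure set (measurableTypeR R) -> \bar R}) (U : R -> R) :
    Prop :=
  exists g h : cumulative R R,
    let V := fun x : R => g x - h x in
    (forall a b : R, a <= b ->
       U b - U a = \int[lebesgue_measure]_(x in `[a, b]) V x) /\
    (forall A : set (measurableTypeR R),
       measurable A -> bounded_set (A : set R) ->
       (fine (lebesgue_stieltjes_measure g A)
          - fine (lebesgue_stieltjes_measure h A))
       + c * (\int[lebesgue_measure]_(x in A) V x)
       + \int[lebesgue_measure]_(x in A) f (U x)
       = fine (mu A)).

(* The set M_c.  Every finite Borel measure on the line is Radon. *)
Definition admissible (R : realType) (f : R -> R) (c : R) :
    set {finite_measure set (measurableTypeR R) -> \bar R} :=
  [set mu | exists U : R -> R,
     [/\ {homo U : x y / x <= y}, from0to1 U & measure_solution f c mu U]].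

Definition costs (R : realType) (f : R -> R) (c : R) : set R :=
  [set fine (mu setT) | mu in admissible f c].

Definition min_cost (R : realType) (f : R -> R) (c : R) : R :=
  inf (costs f c).

(* Main.v *)
Require Import Defs.
From HB Require Import structures.
From mathcomp Require Import all_boot all_order all_algebra.
From mathcomp Require Import all_classical all_reals all_analysis.
From mathcomp Require Import measurable_realfun.
From mathcomp Require Import ring lra.

Set Implicit Arguments.
Unset Strict Implicit.
Unset Printing Implicit Defensive.

Import Order.TTheory GRing.Theory Num.Theory.
Import numFieldNormedType.Exports.

Local Open Scope classical_set_scope.
Local Open Scope ring_scope.

(** The problem becomes one-dimensional in the phase plane. Along a wave, write
    the slope as a function of the height, [U' = P(U)]; where the control [mu]
    has no mass, the equation [U'' + c U' + f(U) = 0] reads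
    [P' = - c - f / P]. Since the slope vanishes at both ends, integrating the
    equation over the line gives the cost [c + \int f(U) dx], that is
    [c + \int_0^1 f(u) / P(u) du]: cheap controls are those with steep waves.

    There is a steepest profile [P_c]: the solution of [P' = - c - f / P] on
    [[0, 1]] with [P(1) = 0]. A control can only push the slope up, so if the
    slope of a wave ever exceeded [P_c(U)], the excess [U' - P_c(U)] would never
    decrease again (lemma [slope_le_profile]) and [U] would overshoot 1.
    Replacing the slope by [P_c] in the cost yields the lower bound
    [c + \int_0^1 f / P_c = P_c(0)]. This bound is attained: a wave can stay at 0
    until some point, receive there the slope [P_c(0)] from a Dirac mass, and
    then follow [P_c] without control up to 1; when [P_c(0) = 0] it follows [P_c]
    on the whole line and no control is used. Hence [E(c) = P_c(0)] (lemma
    [min_cost_profile]).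

    What remains concerns the dependence of [P_c(0)] on [c] and rests on the
    comparison principle [profile_le]: a supersolution that is nonnegative at 1
    lies above [P_c]. A convex combination of [P_c1] and [P_c2] is a
    supersolution for the combined speed because [x -> 1 / x] is convex, whence
    the convexity of [E]. [P_c2] is a supersolution for every speed [c1 < c2],
    whence [P_c1 <= P_c2]; equality at 0 with a positive value is impossible
    because there the derivatives differ by [c2 - c1]. Finally [P_c(0) > 0] for
    [c > c^*]: otherwise a wave following [P_c] would need no control at all,
    and would be a traveling wave with a supercritical speed.

    The profile is obtained as [P = sqrt (2 q)], where [q' = - c sqrt (2 q) - f]
    and [q(1) = 0]; the right-hand side is continuous but not Lipschitz at the
    terminal value, so that Peano's theorem is required. It is proved by
    Perron's method, as is convenient in dimension one: the supremum of all
    subsolutions is a solution. The same theorem provides the waves, by solving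
    [U' = P(U)].

    A wave in the sense of measures has a slope [V] that is merely right
    continuous, and [U] has [V] as right derivative everywhere. Along such
    waves monotonicity is therefore derived from right derivatives (lemma
    [gap_persists]). *)

(** * Estimates for derivatives, one-sided derivatives and continuity *)

Lemma is_derive_estimate (R : realType) (Y : R -> R) (t g : R) :
  (forall e, 0 < e -> exists2 d, 0 < d &
     forall h, `|h| <= d -> `|Y (t + h) - Y t - g * h| <= e * `|h|) ->
  is_derive t 1 Y g.
Proof.
move=> Yg.
have cv : h^-1 *: ((Y \o shift t) (h *: 1) - Y t) @[h --> 0^'] --> g.
  apply/cvgrPdist_le => e e0; have [d d0 Hd] := Yg e e0.
  near=> h.
  have h0 : h != 0 by near: h; exact: nbhs_dnbhs_neq.
  have hd : `|h| <= d.
    near: h; apply: nbhs_dnbhs; apply/nbhs_normP; exists d => //= h /=.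
    by rewrite sub0r normrN => /ltW.
  rewrite /= /shift /= scaler1 (addrC h) -(ler_pM2l (x := `|h|)) ?normr_gt0//.
  rewrite -normrM mulrBr /GRing.scale /= mulVKf// distrC (mulrC h g).
  by rewrite (mulrC _ e) Hd.
have dY : derivable Y t 1 by apply/cvg_ex; exists g.
by apply: DeriveDef => //; exact: (cvg_lim _ cv).
Unshelve. all: by end_near. Qed.

Lemma derive_estimate (R : realType) (Y : R -> R) (t g : R) :
  is_derive t 1 Y g ->
  forall e, 0 < e -> exists2 d, 0 < d &
     forall h, `|h| <= d -> `|Y (t + h) - Y t - g * h| <= e * `|h|.
Proof.
move=> [dY Yg] e e0.
have /cvgrPdist_le /(_ e e0) : h^-1 *: ((Y \o shift t) (h *: 1) - Y t) @[h --> 0^'] --> g.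
  by rewrite -Yg; exact: dY.
move=> /nbhs_ballP[d /= d0 Hd].
exists (d / 2); first by rewrite divr_gt0.
move=> h hd; have [->|h0] := eqVneq h 0; first by rewrite addr0 mulr0 subrr subr0 normr0 mulr0.
have /Hd : ball 0 d h.
  by rewrite /ball /= sub0r normrN (le_lt_trans hd)// ltr_pdivrMr// ltr_pMr// ltr1n.
move=> /(_ h0); rewrite /= /shift /= scaler1 (addrC h).
rewrite -(ler_pM2l (x := `|h|)) ?normr_gt0//.
by rewrite -normrM mulrBr /GRing.scale /= mulVKf// distrC (mulrC h g) (mulrC _ e).
Qed.

(** Stated as a quantitative estimate, in the form in which it is combined with
    real induction on intervals. *)
Definition has_right_derivative (R : realType) (y : R -> R) (x g : R) : Prop :=
  forall e, 0 < e -> exists2 d, 0 < d &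
    forall h, 0 <= h <= d -> `|y (x + h) - y x - g * h| <= e * h.

Lemma right_continuous_estimate (R : realType) (g : R -> R) (x e : R) :
  g @ at_right x --> g x -> 0 < e -> exists2 d, 0 < d &
    forall h, 0 <= h <= d -> `|g (x + h) - g x| <= e.
Proof.
move=> gx e0; have /cvgrPdist_le/(_ e e0)/nbhs_ballP[d /= d0 Hd] := gx.
exists (d / 2); first by rewrite divr_gt0.
move=> h /andP[h0 hd]; have [->|hn0] := eqVneq h 0.
  by rewrite addr0 subrr normr0 ltW.
rewrite distrC; apply: Hd; last by rewrite /= ltrDl lt_neqAle eq_sym hn0.
rewrite /ball /= opprD addrA subrr add0r normrN ger0_norm//.
by rewrite (le_lt_trans hd)// ltr_pdivrMr// ltr_pMr// ltr1n.
Qed.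

Lemma continuous_estimate (R : realType) (g : R -> R) (x e : R) :
  {for x, continuous g} -> 0 < e -> exists2 d, 0 < d &
    forall y, `|y - x| <= d -> `|g y - g x| <= e.
Proof.
move=> gx e0; have /cvgrPdist_le/(_ e e0)/nbhs_ballP[d /= d0 Hd] := gx.
exists (d / 2); first by rewrite divr_gt0.
move=> y yd; rewrite distrC; apply: Hd; rewrite /ball /= distrC.
by rewrite (le_lt_trans yd)// ltr_pdivrMr// ltr_pMr// ltr1n.
Qed.

Lemma locally_lipschitz_continuous (R : realType) (g : R -> R) (x r C : R) :
    0 < r ->
    (forall a b, x - r <= a -> a <= b -> b <= x + r -> `|g b - g a| <= C * (b - a)) ->
  {for x, continuous g}.
Proof.
move=> r0 gC; apply/cvgrPdist_le => e e0.
pose d := Num.min r (e / (`|C| + 1)).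
have C1 : 0 < `|C| + 1 by rewrite ltr_wpDl.
have d0 : 0 < d by rewrite lt_min r0 divr_gt0.
apply/nbhs_ballP; exists d => //= y; rewrite /ball /= => yd.
have yr : `|x - y| <= r by rewrite ltW// (lt_le_trans yd)// ge_min lexx.
have ye : (`|C| + 1) * `|x - y| <= e.
  rewrite mulrC -ler_pdivlMr// ltW// (lt_le_trans yd)// ge_min lexx.
  by rewrite orbT.
have CC : C * `|x - y| <= (`|C| + 1) * `|x - y|.
  by rewrite ler_wpM2r// (le_trans (ler_norm _))// lerDl.
apply: le_trans (le_trans CC ye).
move: yr; rewrite ler_norml => /andP[yr1 yr2].
have [xy|yx] := leP x y.
  rewrite distrC (distrC x) (ger0_norm (x := y - x)) ?subr_ge0//.
  by apply: gC => //; lra.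
have xy0 : 0 <= x - y by rewrite subr_ge0 ltW.
by rewrite (ger0_norm xy0); apply: gC; lra.
Qed.

Lemma derivable_continuous_at (R : realType) (g : R -> R) (x : R) :
  derivable g x 1 -> {for x, continuous g}.
Proof. by move=> /derivable1_diffP/differentiable_continuous. Qed.

Lemma is_derive_continuous_at (R : realType) (g : R -> R) (x d : R) :
  is_derive x 1 g d -> {for x, continuous g}.
Proof. by move=> [gx _]; exact: derivable_continuous_at. Qed.

Lemma is_derive_right (R : realType) (g : R -> R) (x d : R) :
  is_derive x 1 g d -> has_right_derivative g x d.
Proof.
move=> gx e e0; have [r r0 Hr] := derive_estimate gx e0; exists r => // h /andP[h0 hr].
by rewrite -{3}(ger0_norm h0) Hr// ger0_norm.
Qed.

Lemma mean_value (R : realType) (g dg : R -> R) (a b : R) : a < b ->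
    (forall x : R, is_derive x 1 g (dg x)) ->
  exists2 x, a < x < b & g b - g a = dg x * (b - a).
Proof.
move=> ab gE; have [|x xab gx] := MVT ab (fun x _ => gE x).
  by apply: continuous_subspaceT => x; exact: is_derive_continuous_at.
by exists x; rewrite // -in_itv.
Qed.

(** Real induction: the points up to which [phi <= 0] form an interval, whose
    supremum belongs to it by continuity and cannot lie before [b] by the last
    hypothesis. *)
Lemma barrier (R : realType) (phi : R -> R) (a b : R) : a <= b ->
    (forall x, a <= x <= b -> {for x, continuous phi}) -> phi a <= 0 ->
    (forall x, a <= x < b -> phi x <= 0 ->
       exists2 d, 0 < d & forall h, 0 <= h <= d -> phi (x + h) <= 0) ->
  phi b <= 0.
Proof.
move=> ab cphi phia step.
pose S := [set x | a <= x <= b /\ forall y, a <= y <= x -> phi y <= 0].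
have Sa : S a.
  split; first by rewrite lexx.
  by move=> y /andP[ya ay]; have -> : y = a by apply/le_anti; rewrite ya ay.
have hS : has_sup S by split; [exists a|exists b => x [/andP[]]].
set s := sup S.
have as_ : a <= s by apply: ub_le_sup => //; case: hS.
have sb : s <= b by apply: ge_sup; [exists a|move=> x [/andP[]]].
have below y : a <= y -> y < s -> phi y <= 0.
  move=> ay ys; have sy : 0 < s - y by rewrite subr_gt0.
  have [x [_ Sx] yx] := sup_adherent sy hS.
  by apply: Sx; rewrite ay/= ltW//; move: yx; rewrite -/s; lra.
have phis : phi s <= 0.
  have [->//|sa] := eqVneq s a.
  have {}as_ : a < s by rewrite lt_neqAle eq_sym sa.
  rewrite leNgt; apply/negP => phis.
  have p2 : 0 < phi s / 2 by rewrite divr_gt0.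
  have [|d d0 Hd] := continuous_estimate (cphi s _) p2; first by rewrite ltW.
  pose y := Num.max a (s - d).
  have ys : y < s by rewrite gt_max as_/=; lra.
  have ay : a <= y by rewrite le_max lexx.
  have := below y ay ys; have : `|y - s| <= d.
    have : s - d <= y by rewrite le_max lexx orbT.
    by rewrite ler_norml; lra.
  by move=> /Hd; rewrite ler_norml; lra.
have [<-//|sb'] := eqVneq s b.
have {}sb : s < b by rewrite lt_neqAle sb'.
have [|d d0 Hd] := step s _ phis; first by rewrite as_.
pose t := Num.min b (s + d).
have st : s < t by rewrite lt_min sb/=; lra.
have : S t.
  split; first by rewrite ge_min lexx (le_trans as_ (ltW st)).
  move=> y /andP[ay yt]; have [|sy] := ltP y s; first exact: below.
  have -> : y = s + (y - s) by ring.
  apply: Hd; rewrite subr_ge0 sy/=.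
  by move: yt; rewrite le_min => /andP[_]; lra.
have [_ ubS] := hS.
by move=> /(ub_le_sup ubS); rewrite -/s leNgt st.
Qed.

(** The mechanism behind every comparison below. While the gap [N - H] is
    positive, [H] does not increase, so that the gap does not shrink and stays
    positive: the derivative of [H] has to be controlled only where the gap is
    positive. [N] may jump upwards; this is how a nonnegative control enters. *)
Lemma gap_persists (R : realType) (N H : R -> R) (a b : R) : a <= b ->
    (forall x y, a <= x -> x <= y -> y <= b -> N x <= N y) ->
    (forall x, a <= x <= b -> {for x, continuous H}) ->
    0 < N a - H a ->
    (forall x, a <= x < b -> 0 < N x - H x ->
       exists2 g, g <= 0 & has_right_derivative H x g) ->
  N a - H a <= N b - H b.
Proof.
move=> ab Nnd cH w0 Hd; set w := N a - H a in w0 *.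
suff : H b <= H a by have := Nnd a b (lexx _) ab (lexx _); rewrite /w; lra.
apply/ler_addgt0Pr => e0 e00.
pose k := b - a + 1; have k0 : 0 < k by rewrite /k; lra.
(* a drift e, too small to use up the gap on the interval *)
pose e := Num.min e0 (w / 2) / k.
have e_gt0 : 0 < e by rewrite divr_gt0// lt_min e00 divr_gt0.
have ek : e * k <= e0 by rewrite divfK ?gt_eqF// ge_min lexx.
have ew : e * k <= w / 2 by rewrite divfK ?gt_eqF// ge_min lexx orbT.
suff : H b - H a - e * (b - a) <= 0 by move: ek; rewrite /k; lra.
apply: (barrier (phi := fun x => H x - H a - e * (x - a)) ab).
- move=> x xab; apply: cvgB; last first.
    by apply: cvgM; [exact: cvg_cst|apply: cvgB; [exact: cvg_id|exact: cvg_cst]].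
  by apply: cvgB; [exact: cH|exact: cvg_cst].
- by rewrite !subrr mulr0 subrr.
move=> x /andP[ax xb] phix.
have wx : 0 < N x - H x.
  have := Nnd a x (lexx _) ax (ltW xb).
  have : e * (x - a) <= e * k by rewrite ler_pM2l// /k; lra.
  by move: ew phix w0; rewrite /w; lra.
have [|g g0 Hg] := Hd x _ wx; first by rewrite ax.
have [d d0 {}Hg] := Hg e e_gt0; exists d => // h /andP[h0 hd].
have := Hg h; rewrite h0 hd => /(_ isT); rewrite ler_norml => /andP[_ Hh].
have : g * h <= 0 by rewrite mulr_le0_ge0.
by move: phix; lra.
Qed.

Lemma right_derivative_nonincreasing (R : realType) (H : R -> R) (a b : R) :
    a <= b -> (forall x, a <= x <= b -> {for x, continuous H}) ->
    (forall x, a <= x < b -> exists2 g, g <= 0 & has_right_derivative H x g) ->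
  H b <= H a.
Proof.
move=> ab cH Hd.
have := @gap_persists _ (fun _ => H a + 1) H a b ab.
have h : 0 < H a + 1 - H a by lra.
by move=> /(_ (fun _ _ _ _ _ => lexx _) cH h (fun x xab _ => Hd x xab)); lra.
Qed.

Lemma derive_ge0_le (R : realType) (y dy : R -> R) (a b : R) : a <= b ->
    (forall x : R, is_derive x 1 y (dy x)) ->
    (forall x, a <= x <= b -> 0 <= dy x) ->
  y a <= y b.
Proof.
rewrite le_eqVlt => /predU1P[->//|ab] yd dy0.
have [x /andP[ax xb] E] := mean_value ab yd.
rewrite -subr_ge0 E mulr_ge0 ?subr_ge0; [by []|by apply: dy0; rewrite !ltW|exact: ltW].
Qed.

Lemma has_right_derivativeD (R : realType) (y z : R -> R) (x g k : R) :
  has_right_derivative y x g -> has_right_derivative z x k ->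
  has_right_derivative (fun t => y t + z t) x (g + k).
Proof.
move=> yg zk e e0; have e20 : 0 < e / 2 by rewrite divr_gt0.
have [d d0 Hd] := yg _ e20; have [d' d'0 Hd'] := zk _ e20.
exists (Num.min d d'); first by rewrite lt_min d0.
move=> h; rewrite le_min => /and3P[h0 hd hd'].
have := Hd h; have := Hd' h; rewrite h0 hd hd' => /(_ isT) + /(_ isT).
by rewrite !ler_norml; lra.
Qed.

Lemma has_right_derivativeZ (R : realType) (y : R -> R) (x g c : R) :
  has_right_derivative y x g -> has_right_derivative (fun t => c * y t) x (c * g).
Proof.
move=> yg e e0; have c1 : 0 < `|c| + 1 by rewrite ltr_wpDl.
have [d d0 Hd] := yg _ (divr_gt0 e0 c1); exists d => // h hd.
have h0 : 0 <= h by case/andP: hd.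
have -> : c * y (x + h) - c * y x - c * g * h = c * (y (x + h) - y x - g * h) by ring.
rewrite normrM; apply: le_trans (_ : (`|c| + 1) * (e / (`|c| + 1) * h) <= _).
  by apply: ler_pM => //; [rewrite lerDl|exact: Hd].
by rewrite mulrA (mulrC _ (e / _)) divfK ?gt_eqF.
Qed.

Lemma has_right_derivative_comp (R : realType) (P U : R -> R) (x p v : R) :
  is_derive (U x) 1 P p -> has_right_derivative U x v ->
  has_right_derivative (P \o U) x (p * v).
Proof.
move=> Pp Uv e e0.
have v1 : 0 < `|v| + 1 by rewrite ltr_wpDl.
have p1 : 0 < `|p| + 1 by rewrite ltr_wpDl.
have e20 : 0 < e / 2 by rewrite divr_gt0.
have [r r0 Hr] := derive_estimate Pp (divr_gt0 e20 v1).
have [d d0 Hd] := Uv _ (divr_gt0 e20 p1).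
have [d1 d10 Hd1] := Uv _ (@ltr01 R).
exists (Num.min d (Num.min d1 (r / (`|v| + 1)))).
  by rewrite !lt_min d0 d10 divr_gt0.
move=> h; rewrite !le_min => /and4P[h0 hd hd1 hr].
have := Hd h; have := Hd1 h; rewrite h0 hd hd1 => /(_ isT) Uh1 /(_ isT) Uh.
set k := U (x + h) - U x in Uh Uh1.
have kh : `|k| <= (`|v| + 1) * h.
  have -> : k = (k - v * h) + v * h by ring.
  rewrite (le_trans (ler_normD _ _))// normrM (ger0_norm h0); lra.
have kr : `|k| <= r by rewrite (le_trans kh)// mulrC -ler_pdivlMr.
have kE : U x + k = U (x + h) by rewrite /k; ring.
have := Hr k kr; rewrite kE => Pk.
have -> : (P \o U) (x + h) - (P \o U) x - p * v * h =
  (P (U (x + h)) - P (U x) - p * k) + p * (k - v * h) by rewrite /=; ring.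
rewrite (le_trans (ler_normD _ _))// [leRHS](_ : _ = e / 2 * h + e / 2 * h); last by lra.
apply: lerD.
  apply: le_trans Pk _; rewrite mulrAC -[leLHS]mulrA.
  by apply: ler_wpM2l; [exact: ltW|rewrite ler_pdivrMr// mulrC].
rewrite normrM; apply: le_trans (_ : (`|p| + 1) * (e / 2 / (`|p| + 1) * h) <= _).
  by apply: ler_pM => //; rewrite lerDl.
by rewrite mulrA (mulrC _ (e / 2 / _)) divfK ?gt_eqF.
Qed.

Lemma continuous_ge0_left (R : realType) (D : R -> R) :
  {for 0, continuous D} -> (forall u, 0 < u < 1 -> 0 <= D u) -> 0 <= D 0.
Proof.
move=> cD D0; rewrite leNgt; apply/negP => Dn.
have e0 : 0 < - D 0 / 2 by rewrite divr_gt0// oppr_gt0.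
have [d d0 Hd] := continuous_estimate cD e0.
pose h := Num.min d (1 / 2).
have h0 : 0 < h by rewrite lt_min d0 divr_gt0.
have hd : h <= d by rewrite ge_min lexx.
have h1 : h <= 1 / 2 by rewrite ge_min lexx orbT.
have := Hd h; rewrite subr0 (gtr0_norm h0) => /(_ hd).
have : 0 <= D h by apply: D0; lra.
by rewrite ler_norml; lra.
Qed.

(** * Peano's theorem, by Perron's method *)

Section Perron.
Variables (R : realType) (G : R -> R -> R) (K : R).
Hypothesis G_continuous : forall t v e, 0 < e -> exists2 d, 0 < d &
  forall t' v', `|t' - t| <= d -> `|v' - v| <= d -> `|G t' v' - G t v| <= e.
Hypothesis G_bounded : forall t v, `|G t v| <= K.

Let L := K + 1.

Let K0 : 0 <= K. Proof. exact: le_trans (G_bounded 0 0). Qed.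

(** Instead of a differential inequality, the integrated form on every
    subinterval: it passes to suprema and is stable under concatenation of
    functions, where a bound on a union is a bound on both pieces. The
    normalisation [z 0 = 0] and the Lipschitz bound make the class uniformly
    bounded. *)
Definition subsolution (t : R) (z : R -> R) : Prop :=
  [/\ z 0 = 0,
      forall a b, 0 <= a -> a <= b -> b <= t -> `|z b - z a| <= L * (b - a)
    & forall a b m, 0 <= a -> a <= b -> b <= t ->
        (forall s, a <= s <= b -> G s (z s) <= m) -> z b - z a <= m * (b - a)].

Lemma subsolution_restrict t t' z :
  t <= t' -> subsolution t' z -> subsolution t z.
Proof.
move=> tt' [z0 zL zG]; split=> //.
  by move=> a b a0 ab bt; apply: zL => //; apply: le_trans tt'.
by move=> a b m a0 ab bt; apply: zG => //; apply: le_trans tt'.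
Qed.

(** A segment whose slope lies below [G] along it may be appended to a
    subsolution; this is what prevents the supremum from growing more slowly
    than [G]. *)
Lemma subsolution_extend t t' z k :
    0 <= t -> t <= t' -> subsolution t z -> `|k| <= L ->
    (forall s, t <= s <= t' -> k <= G s (z t + k * (s - t))) ->
  subsolution t' (fun s => if s <= t then z s else z t + k * (s - t)).
Proof.
move=> t0 tt' [z0 zL zG] kL kG; split=> /=; first by rewrite t0.
- move=> a b a0 ab bt'; have [bt|tb] := leP b t.
    by rewrite (le_trans ab bt); exact: zL.
  have [at_|ta] := leP a t; last first.
    rewrite (_ : _ - _ = k * (b - a)); last by ring.
    by rewrite normrM (ger0_norm (x := b - a)) ?subr_ge0// ler_wpM2r ?subr_ge0.
  have := zL a t a0 at_ (lexx t).
  rewrite (_ : z t + _ - _ = (z t - z a) + k * (b - t)); last by ring.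
  move=> h; apply: (le_trans (ler_normD _ _)).
  have bt0 : 0 <= b - t by rewrite subr_ge0 ltW.
  rewrite normrM (ger0_norm bt0).
  by have := ler_wpM2r bt0 kL; lra.
- move=> a b m a0 ab bt' Gm; have [bt|tb] := leP b t.
    rewrite (le_trans ab bt); apply: zG => // s /andP[as_ sb].
    by have := Gm s; rewrite as_ sb (le_trans sb bt); apply.
  have km s : t <= s -> a <= s -> s <= b -> k <= m.
    move=> ts as_ sb; apply: le_trans (kG s _) _.
      by rewrite ts (le_trans sb).
    have := Gm s; rewrite as_ sb => /(_ isT).
    case: (leP s t) => // st; have -> : s = t by apply/le_anti; rewrite st.
    by rewrite subrr mulr0 addr0.
  have [at_|ta] := leP a t; last first.
    rewrite (_ : _ - _ = k * (b - a)); last by ring.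
    by apply: ler_wpM2r; rewrite ?subr_ge0// (km a)// ltW.
  have : z t - z a <= m * (t - a).
    apply: zG => // s /andP[as_ st]; have := Gm s.
    by rewrite as_ st (le_trans st (ltW tb)); apply.
  have bt0 : 0 <= b - t by rewrite subr_ge0 ltW.
  have := ler_wpM2r bt0 (km t (lexx t) at_ (ltW tb)); lra.
Qed.

(** Slope [- L] is always allowed, because [G >= - L]; hence a subsolution can
    be continued for all later times. *)
Lemma subsolution_cone z t t' : 0 <= t -> t <= t' ->
  subsolution t z -> exists2 z', subsolution t' z' & z' t' = z t - L * (t' - t).
Proof.
move=> t0 tt' sz; pose k := - L.
exists (fun s => if s <= t then z s else z t + k * (s - t)).
  apply: subsolution_extend => //; first by rewrite normrN ger0_norm// addr_ge0.
  move=> s _; have := G_bounded s (z t + k * (s - t)).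
  by rewrite ler_norml /k /L => /andP[h _]; lra.
case: leP => [t't|_]; last by rewrite mulNr.
by have -> : t' = t; [apply/le_anti; rewrite tt' t't | rewrite subrr mulr0 subr0].
Qed.

Definition perron (t : R) : R := sup [set z t | z in subsolution t].

Lemma subsolution0 : subsolution 0 (fun _ => 0).
Proof.
split=> // a b; rewrite ?subrr ?normr0.
  by move=> *; rewrite mulr_ge0 ?subr_ge0 ?addr_ge0.
move=> m a0 ab b0 _; have -> : a = b by apply/le_anti; rewrite ab (le_trans b0).
by rewrite !subrr mulr0.
Qed.

Lemma perron_has_sup t : 0 <= t -> has_sup [set z t | z in subsolution t].
Proof.
move=> t0; split.
  have [z sz zt] := subsolution_cone (lexx 0) t0 subsolution0.
  by exists (z t); exists z.
exists (L * t) => _ [z [z0 zL _] <-].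
have := zL 0 t (lexx 0) t0 (lexx t); rewrite z0 !subr0.
exact: le_trans (ler_norm _).
Qed.

Lemma perron_ub t z : 0 <= t -> subsolution t z -> z t <= perron t.
Proof.
move=> t0 sz; have [_ hs] := perron_has_sup t0.
by apply: ub_le_sup => //; exists z.
Qed.

Lemma perron_le t v : 0 <= t -> (forall z, subsolution t z -> z t <= v) ->
  perron t <= v.
Proof.
move=> t0 zv; apply: ge_sup; first by case: (perron_has_sup t0).
by move=> _ [z sz <-]; exact: zv.
Qed.

Lemma perron_adherent t e : 0 <= t -> 0 < e ->
  exists2 z, subsolution t z & perron t - e < z t.
Proof.
move=> t0 e0; have [_ [z sz <-] h] := sup_adherent e0 (perron_has_sup t0).
by exists z.
Qed.

Lemma perron_lipschitz t t' : 0 <= t -> t <= t' ->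
  `|perron t' - perron t| <= L * (t' - t).
Proof.
move=> t0 tt'; have t'0 := le_trans t0 tt'.
rewrite ler_distl; apply/andP; split.
  rewrite lerBlDr; apply: perron_le => // z sz.
  have [z' sz' zz'] := subsolution_cone t0 tt' sz.
  by rewrite -lerBlDr -zz'; exact: perron_ub.
apply: perron_le => // z sz.
have : z t <= perron t by apply: perron_ub => //; exact: subsolution_restrict sz.
have [_ zL _] := sz; have := zL t t' t0 tt' (lexx _).
rewrite ler_norml => /andP[_]; lra.
Qed.

(** Both inequalities are uniform for [t <= t'] close to [t0], which gives the
    two-sided derivative. Lower bound: append a segment of slope [g - e1] to a
    nearly optimal subsolution. Upper bound: a subsolution that is optimal at
    [t'] either was close to the supremum at [t], and then grew at most at rate
    [g + e1], or was so far below that the Lipschitz bound alone suffices. *)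
Lemma perron_estimate t0 e : 0 <= t0 -> 0 < e -> exists2 d, 0 < d &
  forall t t', 0 <= t -> t <= t' -> `|t - t0| <= d -> `|t' - t0| <= d ->
  `|perron t' - perron t - G t0 (perron t0) * (t' - t)| <= e * (t' - t).
Proof.
move=> t00 e0; pose e1 := Num.min e 1.
have e10 : 0 < e1 by rewrite lt_min e0 ltr01.
have e11 : e1 <= 1 by rewrite ge_min lexx orbT.
have e1e : e1 <= e by rewrite ge_min lexx.
set y0 := perron t0; set g := G t0 y0.
have [d d0 Hd] := G_continuous t0 y0 e10.
have L1 : 1 <= L by rewrite lerDr.
have L0 : 0 < L by lra.
have gK : `|g| <= K := G_bounded _ _.
have near_y0 t : 0 <= t -> `|perron t - y0| <= L * `|t - t0|.
  move=> tp; have [tt0|t0t] := leP t t0.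
    rewrite distrC (distrC t) (ger0_norm (x := t0 - t)) ?subr_ge0//.
    exact: perron_lipschitz.
  by rewrite (ger0_norm (x := t - t0)) ?subr_ge0; [exact: perron_lipschitz (ltW _)|exact: ltW].
pose r := d / (10%:R * L).
have r0 : 0 < r by rewrite divr_gt0// mulr_gt0.
have rL : L * r = d / 10%:R by rewrite /r; field; rewrite lt0r_neq0//.
have rd : r <= d / 10%:R by rewrite -rL ler_peMl// ltW.
exists r => // t t' tp tt' tr t'r.
have t'p := le_trans tp tt'.
have ht : t' - t <= 2 * r by move: tr t'r; rewrite !ler_norml; lra.
have yt : `|perron t - y0| <= d / 10%:R.
  by rewrite -rL (le_trans (near_y0 _ tp))// ler_wpM2l// ltW.
have Lh : L * (t' - t) <= d / 5%:R.
  by rewrite (le_trans (ler_wpM2l (ltW L0) ht))// mulrCA rL; lra.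
have h0 : 0 <= t' - t by rewrite subr_ge0.
have srd s : t <= s <= t' -> `|s - t0| <= d.
  by move: tr t'r rd; rewrite !ler_norml; lra.
suff : (g - e1) * (t' - t) <= perron t' - perron t <= (g + e1) * (t' - t).
  by rewrite ler_norml; nra.
apply/andP; split.
  apply/ler_addgt0Pr => n n0.
  pose n1 := Num.min n (d / 10%:R).
  have n10 : 0 < n1 by rewrite lt_min n0 divr_gt0.
  have n1n : n1 <= n by rewrite ge_min lexx.
  have n1d : n1 <= d / 10%:R by rewrite ge_min lexx orbT.
  have [z sz zt] := perron_adherent tp n10.
  have ztp : z t <= perron t := perron_ub tp sz.
  pose k := g - e1.
  have kL : `|k| <= L.
    by rewrite (le_trans (ler_normB _ _))// (gtr0_norm e10); apply: lerD.
  have H : (forall s, t <= s <= t' -> k <= G s (z t + k * (s - t))) ->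
      z t + k * (t' - t) <= perron t'.
    move=> /(subsolution_extend tp tt' sz kL) /(perron_ub t'p).
    case: (leP t' t) => // t't; have -> : t' = t by apply/le_anti; rewrite tt' t't.
    by rewrite subrr mulr0 addr0.
  suff : z t + k * (t' - t) <= perron t' by rewrite -/k; lra.
  apply: H => s sts; have sd := srd s sts.
  have : `|z t + k * (s - t) - y0| <= d.
    have ks : `|k * (s - t)| <= d / 5%:R.
      rewrite normrM; apply: le_trans Lh; apply: ler_pM => //.
      by rewrite ger0_norm; lra.
    by move: ks yt; rewrite !ler_norml; lra.
  by move=> /(Hd _ _ sd); rewrite -/g ler_norml /k; lra.
rewrite lerBlDr; apply: perron_le => // z sz.
have [_ zL zG] := sz.
have ztp : z t <= perron t by apply: perron_ub => //; exact: subsolution_restrict sz.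
have [far|close] := leP (z t) (perron t - 2 * (L * (t' - t))).
  have := zL t t' tp tt' (lexx _); rewrite ler_norml => /andP[_ zt'].
  have : - (L * (t' - t)) <= (g + e1) * (t' - t).
    by rewrite -mulNr ler_wpM2r//; move: gK; rewrite ler_norml /L; lra.
  by lra.
have : z t' - z t <= (g + e1) * (t' - t).
  apply: zG => // s sts; have sd := srd s sts.
  have : `|z s - y0| <= d.
    have : `|z s - z t| <= d / 5%:R.
      have [ts st'] := andP sts.
      apply: le_trans (zL t s tp ts st') _; apply: le_trans Lh.
      by apply: ler_wpM2l; [exact: ltW|rewrite lerD2r].
    by move: yt; rewrite !ler_norml; lra.
  by move=> /(Hd _ _ sd); rewrite -/g ler_norml; lra.
by lra.
Qed.

Lemma perron0 : perron 0 = 0.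
Proof.
apply/le_anti/andP; split; first by apply: perron_le => // z [-> _ _].
exact: (perron_ub (lexx 0) subsolution0).
Qed.

End Perron.

(** The initial time is moved to the origin, and past times are treated by
    reversing time; the two pieces match at the initial time because both have
    the slope [G t0 y0] there. *)
Lemma peano (R : realType) (G : R -> R -> R) (K t0 y0 : R) :
    (forall t v e, 0 < e -> exists2 d, 0 < d & forall t' v',
       `|t' - t| <= d -> `|v' - v| <= d -> `|G t' v' - G t v| <= e) ->
    (forall t v, `|G t v| <= K) ->
  exists2 Y : R -> R, Y t0 = y0 & forall t : R, is_derive t 1 Y (G t (Y t)).
Proof.
move=> Gc GK.
pose Gr t v := G (t0 + t) (y0 + v); pose Gl t v := - G (t0 - t) (y0 + v).
have GrK t v : `|Gr t v| <= K by exact: GK.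
have GlK t v : `|Gl t v| <= K by rewrite normrN; exact: GK.
have Grc t v e : 0 < e -> exists2 d, 0 < d & forall t' v',
    `|t' - t| <= d -> `|v' - v| <= d -> `|Gr t' v' - Gr t v| <= e.
  move=> e0; have [d d0 Hd] := Gc (t0 + t) (y0 + v) e e0; exists d => // t' v' h h'.
  by apply: Hd; [rewrite (_ : _ - _ = t' - t)//; ring|rewrite (_ : _ - _ = v' - v)//; ring].
have Glc t v e : 0 < e -> exists2 d, 0 < d & forall t' v',
    `|t' - t| <= d -> `|v' - v| <= d -> `|Gl t' v' - Gl t v| <= e.
  move=> e0; have [d d0 Hd] := Gc (t0 - t) (y0 + v) e e0; exists d => // t' v' h h'.
  rewrite /Gl -opprD normrN; apply: Hd.
    by rewrite (_ : _ - _ = - (t' - t)) ?normrN//; ring.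
  by rewrite (_ : _ - _ = v' - v)//; ring.
pose yr := perron Gr K; pose yl := perron Gl K.
pose Y t := y0 + (if t0 <= t then yr (t - t0) else yl (t0 - t)).
have Yr t : t0 <= t -> Y t = y0 + yr (t - t0) by rewrite /Y => ->.
have Yl t : t <= t0 -> Y t = y0 + yl (t0 - t).
  rewrite /Y; case: (leP t0 t) => // h h'; have -> : t = t0 by apply/le_anti; rewrite h h'.
  by rewrite subrr /yr /yl (perron0 GrK) (perron0 GlK).
exists Y; first by rewrite Yr// subrr /yr (perron0 GrK) addr0.
move=> t; apply: is_derive_estimate => e e0.
have Hr : t0 <= t -> exists2 d, 0 < d & forall h, `|h| <= d -> t0 <= t + h ->
    `|Y (t + h) - Y t - G t (Y t) * h| <= e * `|h|.
  move=> t0t; have tt0 : 0 <= t - t0 by rewrite subr_ge0.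
  have [d d0 Hd] := perron_estimate Grc GrK tt0 e0.
  exists d => // h hd h0; rewrite (Yr _ h0) (Yr _ t0t).
  have GE : Gr (t - t0) (yr (t - t0)) = G t (y0 + yr (t - t0)).
    by rewrite /Gr; congr G; ring.
  have [hn|hp] := leP h 0.
    have := Hd (t + h - t0) (t - t0); rewrite -/yr GE.
    rewrite subrr normr0 subr_ge0 h0 lerD2r gerDl hn.
    rewrite (_ : t + h - t0 - _ = h); last by ring.
    rewrite (_ : t - t0 - _ = - h); last by ring.
    rewrite hd (ltW d0) => /(_ isT isT isT isT).
    by rewrite (ler0_norm hn) -normrN; congr (`|_| <= _); ring.
  have := Hd (t - t0) (t + h - t0); rewrite -/yr GE.
  rewrite subrr normr0 subr_ge0 t0t lerD2r lerDl (ltW hp).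
  rewrite (_ : t + h - t0 - _ = h); last by ring.
  rewrite hd (ltW d0) => /(_ isT isT isT isT).
  by rewrite (gtr0_norm hp); congr (`|_| <= _); ring.
have Hl : t <= t0 -> exists2 d, 0 < d & forall h, `|h| <= d -> t + h <= t0 ->
    `|Y (t + h) - Y t - G t (Y t) * h| <= e * `|h|.
  move=> tt0; have t0t : 0 <= t0 - t by rewrite subr_ge0.
  have [d d0 Hd] := perron_estimate Glc GlK t0t e0.
  exists d => // h hd h0; rewrite (Yl _ h0) (Yl _ tt0).
  have GE : Gl (t0 - t) (yl (t0 - t)) = - G t (y0 + yl (t0 - t)).
    by rewrite /Gl; congr (- G _ _); ring.
  have [hn|hp] := leP h 0.
    have := Hd (t0 - t) (t0 - (t + h)); rewrite -/yl GE.
    rewrite subrr normr0 subr_ge0 tt0 lerD2l lerN2 gerDl hn.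
    rewrite (_ : t0 - (t + h) - _ = - h); last by ring.
    rewrite normrN hd (ltW d0) => /(_ isT isT isT isT).
    by rewrite (ler0_norm hn); congr (`|_| <= _); ring.
  have := Hd (t0 - (t + h)) (t0 - t); rewrite -/yl GE.
  rewrite subrr normr0 subr_ge0 h0 lerD2l lerN2 lerDl (ltW hp).
  rewrite (_ : t0 - (t + h) - _ = - h); last by ring.
  rewrite (_ : t0 - t - _ = h); last by ring.
  rewrite normrN hd (ltW d0) => /(_ isT isT isT isT).
  by rewrite (gtr0_norm hp) -normrN; congr (`|_| <= _); ring.
have [tt0|t0t|tE] := ltgtP t t0.
- have [d d0 Hd] := Hl (ltW tt0).
  exists (Num.min d (t0 - t)); first by rewrite lt_min d0 subr_gt0.
  move=> h; rewrite le_min => /andP[hd ht]; apply: Hd => //.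
  by move: ht; rewrite ler_norml; lra.
- have [d d0 Hd] := Hr (ltW t0t).
  exists (Num.min d (t - t0)); first by rewrite lt_min d0 subr_gt0.
  move=> h; rewrite le_min => /andP[hd ht]; apply: Hd => //.
  by move: ht; rewrite ler_norml; lra.
- have [d d0 Hd] : exists2 d, 0 < d & forall h, `|h| <= d -> t + h <= t0 ->
      `|Y (t + h) - Y t - G t (Y t) * h| <= e * `|h| by apply: Hl; rewrite tE.
  have [d' d'0 Hd'] : exists2 d, 0 < d & forall h, `|h| <= d -> t0 <= t + h ->
      `|Y (t + h) - Y t - G t (Y t) * h| <= e * `|h| by apply: Hr; rewrite tE.
  exists (Num.min d d'); first by rewrite lt_min d0.
  move=> h; rewrite le_min => /andP[hd hd'].
  by have [?|/ltW ?] := leP (t + h) t0; [apply: Hd|apply: Hd'].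
Qed.

Lemma peano_sum (R : realType) (a b : R -> R) (A B t0 y0 : R) :
    continuous a -> continuous b ->
    (forall t, `|a t| <= A) -> (forall y, `|b y| <= B) ->
  exists2 Y : R -> R, Y t0 = y0 &
    forall t : R, is_derive t 1 Y (a t + b (Y t)).
Proof.
move=> ca cb aA bB.
apply: (@peano _ (fun t y => a t + b y) (A + B)) => [t v e e0|t v]; last first.
  by rewrite (le_trans (ler_normD _ _))// lerD.
have e20 : 0 < e / 2 by rewrite divr_gt0.
have [d d0 Hd] := continuous_estimate (ca t) e20.
have [d' d'0 Hd'] := continuous_estimate (cb v) e20.
exists (Num.min d d'); first by rewrite lt_min d0.
move=> t' v'; rewrite !le_min => /andP[/Hd + _] /andP[_ /Hd'].
by rewrite !ler_norml; lra.
Qed.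

(** * Monostable nonlinearities *)

Section Monostable.
Variables (R : realType) (f : R -> R).
Hypothesis hf : monostable f.

Lemma monostable_derive (x : R) : is_derive x 1 f (f^`()%classic x).
Proof. by case: hf => [[df _ _] _ _ _]; rewrite derive1E; exact: derivableP. Qed.

Lemma monostable_continuous : continuous f.
Proof. by move=> x; exact: is_derive_continuous_at (monostable_derive x). Qed.

Lemma monostable_derive_decr (x y : R) : 0 <= x -> x < y -> y <= 1 ->
  f^`()%classic y < f^`()%classic x.
Proof.
move=> x0 xy y1; case: hf => [[_ df' _] _ _ f''].
have f'd (z : R) : is_derive z 1 (f^`()%classic) (f^`(2)%classic z).
  have -> : f^`(2)%classic z = 'D_1 (f^`()%classic) z by rewrite -derive1E.
  exact: derivableP.
have [z /andP[xz zy] E] := mean_value xy f'd.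
have h : f^`(2)%classic z < 0 by apply: f''; lra.
by rewrite -subr_lt0 E nmulr_rlt0// subr_gt0.
Qed.

(** A nonpositive value inside would make the derivative nonpositive somewhere
    before that point and nonnegative somewhere after it, against strict
    concavity. *)
Lemma monostable_gt0 (u : R) : 0 < u < 1 -> 0 < f u.
Proof.
move=> /andP[u0 u1]; case: hf => [_ f0 f1 _].
rewrite ltNge; apply/negP => fu.
have [x /andP[x0 xu]] := mean_value u0 monostable_derive.
have [y /andP[uy y1]] := mean_value u1 monostable_derive.
rewrite f0 f1 !subr0 sub0r => Ey Ex.
have : f^`()%classic y < f^`()%classic x by apply: monostable_derive_decr; lra.
have : f^`()%classic x <= 0 by rewrite -(pmulr_lle0 _ u0) -Ex.
have : 0 <= f^`()%classic y.
  have u10 : 0 < 1 - u by lra.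
  by rewrite -(pmulr_lge0 _ u10) -Ey oppr_ge0.
by lra.
Qed.

Lemma monostable_ge0 (u : R) : 0 <= u <= 1 -> 0 <= f u.
Proof.
case: hf => [_ f0 f1 _] /andP[u0 u1].
have [<-|un0] := eqVneq 0 u; first by rewrite f0.
have [->|un1] := eqVneq u 1; first by rewrite f1.
by apply/ltW/monostable_gt0; rewrite !lt_neqAle un0 un1 u0.
Qed.

Lemma monostable_le_linear : exists2 M, 0 < M &
  forall u, 0 <= u <= 1 -> f u <= M * (1 - u).
Proof.
case: hf => [_ f0 f1 _].
exists (`|f^`()%classic 1| + 1); first by rewrite ltr_wpDl.
move=> u /andP[u0]; rewrite le_eqVlt => /predU1P[->|u1].
  by rewrite f1 subrr mulr0.
have [x /andP[ux x1]] := mean_value u1 monostable_derive.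
have : f^`()%classic 1 < f^`()%classic x by apply: monostable_derive_decr; lra.
rewrite f1 sub0r => fx E.
have -> : f u = - f^`()%classic x * (1 - u) by rewrite mulNr -E opprK.
apply: ler_wpM2r; first by lra.
have := ler_norm (- f^`()%classic 1); rewrite normrN; lra.
Qed.

End Monostable.

(** * The extremal slope profile *)

(** Truncation to [[0, B]], used to make right-hand sides bounded without
    changing them on the relevant range. *)
Definition clamp (R : realType) (B y : R) : R := Num.max 0 (Num.min B y).

Lemma clamp_id (R : realType) (B y : R) : 0 <= y <= B -> clamp B y = y.
Proof. by move=> /andP[y0 yB]; rewrite /clamp min_r// max_r. Qed.

Lemma clamp_itv (R : realType) (B y : R) : 0 <= B -> 0 <= clamp B y <= B.
Proof. by move=> B0; rewrite le_max lexx/= ge_max B0 ge_min lexx. Qed.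

Lemma clamp_continuous (R : realType) (B : R) : continuous (@clamp R B).
Proof.
move=> x; apply: continuous_max; first exact: cvg_cst.
by apply: continuous_min; [exact: cvg_cst|exact: cvg_id].
Qed.

Lemma is_derive_sqrt_comp (R : realType) (q : R -> R) (x dq : R) :
    is_derive x 1 q dq -> 0 < q x ->
  is_derive x 1 (fun y => Num.sqrt (2 * q y)) (dq / Num.sqrt (2 * q x)).
Proof.
move=> qx q0; have q2 : 0 < 2 * q x by rewrite mulr_gt0.
have -> : (fun y => Num.sqrt (2 * q y)) = Num.sqrt \o (2 \*: q) by [].
have d2q : is_derive x 1 (2 \*: q) (2 * dq) by exact: is_deriveZ.
have H := @is_derive1_comp R Num.sqrt (2 \*: q) x _ _ (is_derive1_sqrt q2) d2q.
rewrite (_ : dq / _ = (2 * Num.sqrt (2 * q x))^-1 * (2 * dq))//.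
by field; rewrite gt_eqF// sqrtr_gt0.
Qed.

(** The derivative at the end point 0 is two-sided when [0 < P 0]: profiles for
    different speeds are compared there through their derivatives. Where [P]
    vanishes the equation is singular. *)
Definition profile (R : realType) (f : R -> R) (c : R) (P : R -> R) : Prop :=
  [/\ continuous P, P 1 = 0, 0 <= P 0, forall u, 0 < u < 1 -> 0 < P u
    & forall u : R, 0 <= u < 1 -> 0 < P u ->
        is_derive u 1 P (- c - f u / P u)].

(** For [q = P ^ 2 / 2] the equation is [q' = - c sqrt (2 q) - f] with
    [q 1 = 0], which is regular enough for Peano's theorem once [q] is
    truncated. Backwards from 1, [q] cannot become negative, because there
    [q' = - f <= 0]; nor can it vanish inside, because there [q' = - f < 0]. The
    level [B] of the truncation is so large that the truncated equation gives
    [q' >= - B], hence [q <= B] on [[0, 1]], where [q] thus solves the original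
    equation. *)
Lemma profile_exists (R : realType) (f : R -> R) (c : R) :
  monostable f -> exists P, profile f c P.
Proof.
move=> hf; have cf := monostable_continuous hf.
have [M M0 fM] := monostable_le_linear hf.
have fM' u : 0 <= u <= 1 -> `|f u| <= M.
  move=> u01; rewrite ger0_norm ?(monostable_ge0 hf)//.
  by rewrite (le_trans (fM u u01))// ger_pMr//; lra.
(* b = sqrt (2 B) satisfies |c| b + M <= B *)
pose b := 2 * `|c| + M + 2; pose B := b ^+ 2 / 2.
have b2 : 2 <= b by have := normr_ge0 c; rewrite /b; lra.
have b0 : 0 <= b by lra.
have B0 : 0 <= B by rewrite divr_ge0// exprn_ge0.
pose S y := Num.sqrt (2 * clamp B y).
have S_le y : 0 <= S y <= b.
  rewrite sqrtr_ge0/= /S -(ger0_norm b0) -sqrtr_sqr ler_wsqrtr//.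
  by have := clamp_itv y B0; rewrite /B; lra.
have cS : continuous S.
  move=> y; apply: continuous_comp; last exact: sqrt_continuous.
  by apply: cvgM; [exact: cvg_cst|exact: clamp_continuous].
have [q q1 dq] : exists2 q : R -> R, q 1 = 0 &
    forall u : R, is_derive u 1 q (- f (clamp 1 u) + - c * S (q u)).
  apply: (@peano_sum _ (fun u => - f (clamp 1 u)) (fun y => - c * S y) M (`|c| * b)).
  - move=> u; apply: cvgN; apply: continuous_comp; last exact: cf.
    exact: clamp_continuous.
  - by move=> y; apply: cvgM; [exact: cvg_cst|exact: cS].
  - by move=> u; rewrite normrN; apply: fM'; exact: clamp_itv.
  - move=> y; rewrite normrM normrN ler_wpM2l//.
    by have /andP[S0 Sb] := S_le y; rewrite ger0_norm.
have cq : continuous q by move=> u; exact: is_derive_continuous_at (dq u).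
have q_le u : 0 <= u <= 1 -> q u <= B.
  move=> /andP[u0]; rewrite le_eqVlt => /predU1P[->|u1]; first by rewrite q1.
  have [x /andP[ux x1]] := mean_value u1 dq.
  rewrite q1 sub0r => E; have {E} : q u = (f (clamp 1 x) + c * S (q x)) * (1 - u) by lra.
  move=> ->; have : f (clamp 1 x) + c * S (q x) <= B.
    have := fM' _ (clamp_itv x (@ler01 R)); rewrite ler_norml => /andP[_ fx].
    have /andP[S0 Sb] := S_le (q x).
    have : c * S (q x) <= `|c| * b.
      by apply: le_trans (ler_norm _) _; rewrite normrM ler_wpM2l// ger0_norm.
    have : b * (2 * `|c| + M + 2) <= 2 * B by rewrite /B expr2 -/b; lra.
    have : b * M >= 2 * M by rewrite ler_wpM2r// ltW.
    by lra.
  by nra.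
have S0E y : y <= 0 -> S y = 0.
  move=> y0; rewrite /S /clamp max_l ?mulr0 ?sqrtr0//.
  by rewrite ge_min y0 orbT.
have q_ge0 u : 0 <= u <= 1 -> 0 <= q u.
  move=> /andP[u0 u1]; rewrite leNgt; apply/negP => qu.
  have w0 : 0 < 0 - q u by lra.
  have H := @gap_persists _ (fun _ => 0) q u 1 u1
    (fun _ _ _ _ _ => lexx _) (fun x _ => cq x) w0 _.
  suff : 0 - q u <= 0 - q 1 by rewrite q1; lra.
  apply: H => x /andP[ux x1]; rewrite sub0r oppr_gt0 => qx.
  exists (- f (clamp 1 x) + - c * S (q x)); last exact: is_derive_right.
  rewrite (S0E _ (ltW qx)) mulr0 addr0 oppr_le0.
  by apply: (monostable_ge0 hf); exact: clamp_itv.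
have q_gt0 u : 0 < u < 1 -> 0 < q u.
  move=> /andP[u0 u1]; rewrite lt_neqAle eq_sym q_ge0 ?andbT; last by rewrite !ltW.
  apply/eqP => qu.
  have fu : 0 < f u by apply: (monostable_gt0 hf); rewrite u0.
  have := dq u; rewrite clamp_id; last by rewrite !ltW.
  rewrite qu S0E// mulr0 addr0 => dqu.
  have [d d0 Hd] := derive_estimate dqu (divr_gt0 fu (@ltr0n R 2)).
  pose h := Num.min d (1 - u).
  have h0 : 0 < h by rewrite lt_min d0 subr_gt0.
  have hd : h <= d by rewrite ge_min lexx.
  have h1 : h <= 1 - u by rewrite ge_min lexx orbT.
  have := Hd h; rewrite (gtr0_norm h0) => /(_ hd).
  have : 0 <= q (u + h) by apply: q_ge0; lra.
  rewrite qu subr0 ler_norml => qh /andP[_].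
  have : 0 < f u * h by rewrite mulr_gt0.
  by lra.
have SE u : 0 <= u <= 1 -> S (q u) = Num.sqrt (2 * q u).
  by move=> u01; rewrite /S clamp_id// q_ge0//= q_le.
exists (fun u => Num.sqrt (2 * q u)); split.
- move=> u; apply: continuous_comp; last exact: sqrt_continuous.
  by apply: cvgM; [exact: cvg_cst|exact: cq].
- by rewrite q1 mulr0 sqrtr0.
- exact: sqrtr_ge0.
- by move=> u u01; rewrite sqrtr_gt0 mulr_gt0// q_gt0.
- move=> u /andP[u0 u1]; rewrite sqrtr_gt0 pmulr_rgt0// => qu.
  have u01 : 0 <= u <= 1 by rewrite u0 ltW.
  have s0 : Num.sqrt (2 * q u) != 0 by rewrite gt_eqF// sqrtr_gt0 mulr_gt0.
  apply: is_derive_eq (is_derive_sqrt_comp (dq u) qu) _.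
  by rewrite clamp_id// SE//; field.
Qed.

(** Comparison principle. The difference of the equations gives
    [(P - Q)' >= f (P - Q) / (P Q)], so that a positive value of [P - Q]
    persists up to 1, where [P] vanishes and [Q] does not lie below. In this
    direction the singularity of the equation at 1 is harmless. *)
Lemma profile_le (R : realType) (f : R -> R) (c : R) (P Q dQ : R -> R) :
    monostable f -> profile f c P -> continuous Q -> 0 <= Q 1 ->
    (forall u, 0 < u < 1 -> 0 < Q u) ->
    (forall u : R, 0 < u < 1 -> is_derive u 1 Q (dQ u)) ->
    (forall u, 0 < u < 1 -> dQ u <= - c - f u / Q u) ->
  forall u, 0 <= u <= 1 -> P u <= Q u.
Proof.
move=> hf [cP P1 P0 Pp Pd] cQ Q1 Qp Qd Qc.
have main u : 0 < u < 1 -> 0 <= Q u - P u.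
  move=> /andP[u0 u1]; rewrite leNgt; apply/negP => w0.
  have w0' : 0 < 0 - (Q u - P u) by lra.
  have := @gap_persists _ (fun _ => 0) (fun u => Q u - P u) u 1 (ltW u1)
    (fun _ _ _ _ _ => lexx _) _ w0' _.
  rewrite P1 subr0 => H; suff : 0 - (Q u - P u) <= 0 - Q 1 by lra.
  apply: H => [x _|x /andP[ux x1] wx]; first by apply: cvgB; [exact: cQ|exact: cP].
  have x01 : 0 < x < 1 by rewrite (lt_le_trans u0).
  have Qx := Qp _ x01; have Px := Pp _ x01.
  exists (dQ x - (- c - f x / P x)); last first.
    apply: is_derive_right; apply: is_deriveB; first exact: Qd.
    by apply: Pd => //; lra.
  have := Qc x x01.
  suff : f x / P x <= f x / Q x by lra.
  have fx : 0 < f x := monostable_gt0 hf x01.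
  rewrite ler_pM2l// lef_pV2 ?posrE//; lra.
move=> u /andP[u0 u1]; rewrite -subr_ge0.
have [u00|un0] := eqVneq u 0.
  rewrite u00; apply: (@continuous_ge0_left _ (fun u => Q u - P u)) main.
  by apply: cvgB; [exact: cQ|exact: cP].
have [->|un1] := eqVneq u 1; first by rewrite P1 subr0.
by apply: main; rewrite !lt_neqAle eq_sym un0 u0 un1.
Qed.

(** [K (1 - u)] is a supersolution when [K] is large. This bound prevents waves
    from reaching 1 in finite time. *)
Lemma profile_le_linear (R : realType) (f P : R -> R) (c : R) :
    monostable f -> profile f c P ->
  exists2 K, 0 < K & forall u, 0 <= u <= 1 -> P u <= K * (1 - u).
Proof.
move=> hf hP; have [M M0 fM] := monostable_le_linear hf.
have c0 := normr_ge0 c; have cle := ler_norm c.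
exists (`|c| + M + 1); first by lra.
set K := `|c| + M + 1; have K0 : 0 < K by rewrite /K; lra.
apply: (profile_le (Q := fun u => K * (1 - u)) (dQ := fun=> - K) hf hP).
- move=> u; apply: cvgM; first exact: cvg_cst.
  by apply: cvgB; [exact: cvg_cst|exact: cvg_id].
- by rewrite subrr mulr0.
- by move=> u u01; rewrite mulr_gt0//; lra.
- move=> u _.
  have d1 : is_derive u 1 (fun u : R => 1 - u) (0 - 1).
    exact: is_deriveB.
  have d2 : is_derive u 1 (K \*: (fun u : R => 1 - u)) (K *: (0 - 1 : R)) by exact: is_deriveZ.
  by apply: (is_derive_eq d2); rewrite /GRing.scale /=; ring.
- move=> u u01; have u0 : 0 < 1 - u by lra.
  have : f u / (K * (1 - u)) <= 1.
    rewrite ler_pdivrMr ?mulr_gt0// mul1r (le_trans (fM u _))//; first by lra.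
    by rewrite ler_pM2r// /K; lra.
  by rewrite /K; lra.
Qed.

(** When [P 0 = 0], the equation gives [P' <= |c|]. This bound prevents waves
    from leaving 0 at a finite time. *)
Lemma profile_le_linear0 (R : realType) (f P : R -> R) (c : R) :
    monostable f -> profile f c P -> P 0 = 0 ->
  forall u, 0 <= u <= 1 -> P u <= `|c| * u.
Proof.
move=> hf [cP P1 _ Pp dP] P0 u /andP[].
rewrite le_eqVlt => /predU1P[<-|u0]; first by rewrite P0 mulr0.
rewrite le_eqVlt => /predU1P[->|u1]; first by rewrite P1 mulr1.
have dPu x : x \in `]0, u[ -> is_derive x 1 P (- c - f x / P x).
  rewrite in_itv/= => /andP[x0 xu]; apply: dP; first by rewrite ltW//= (lt_trans xu).
  by apply: Pp; rewrite x0 (lt_trans xu).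
have [x xu] := MVT u0 dPu (continuous_subspaceT cP).
move: xu; rewrite in_itv/= => /andP[x0 xu]; have x01 : 0 < x < 1 by rewrite x0 (lt_trans xu).
rewrite P0 !subr0 => ->; rewrite ler_pM2r//.
have : 0 <= f x / P x by rewrite divr_ge0// ltW// ?Pp// (monostable_gt0 hf).
by have := ler_norm (- c); rewrite normrN; lra.
Qed.

(** * Integrals over half-open intervals *)

Lemma fine_lebesgue_measure_oc (R : realType) (a b : R) : a <= b ->
  fine (@lebesgue_measure R `]a, b]) = b - a.
Proof.
by rewrite lebesgue_measure_itv/= lte_fin; case: ltgtP => //= ->; rewrite subrr.
Qed.

Lemma integrable_itvoc (R : realType) (F : R -> R) (a b C : R) :
    measurable_fun setT F -> (forall x, a < x <= b -> `|F x| <= C) ->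
  (@lebesgue_measure R).-integrable `]a, b] (EFin \o F).
Proof.
move=> mF FC; apply: measurable_bounded_integrable => //=.
- by rewrite lebesgue_measure_itv/=; case: ifPn => // _; rewrite -EFinB ltry.
- exact: measurable_funS mF.
- exists C; split; first exact: num_real.
  move=> M CM x /=; rewrite in_itv/= => xab.
  by rewrite (le_trans (FC _ xab))// ltW.
Qed.

Lemma Rintegral_itvcc_oc (R : realType) (F : R -> R) (a b C : R) :
    measurable_fun setT F -> (forall x, a < x <= b -> `|F x| <= C) ->
  \int[lebesgue_measure]_(x in `[a, b]) F x =
  \int[lebesgue_measure]_(x in `]a, b]) F x.
Proof.
move=> mF FC; rewrite Rintegral_itv_obnd_cbnd//.
exact: integrable_itvoc mF FC.
Qed.

Lemma Rintegral_near_cst (R : realType) (F : R -> R) (a b k e : R) : a <= b ->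
    measurable_fun setT F -> (forall x, a < x <= b -> `|F x - k| <= e) ->
  `|\int[lebesgue_measure]_(x in `]a, b]) F x - k * (b - a)| <= e * (b - a).
Proof.
move=> ab mF Fk.
have iF : (@lebesgue_measure R).-integrable `]a, b] (EFin \o F).
  apply: (@integrable_itvoc _ _ _ _ (e + `|k|)) => // x /Fk h.
  by rewrite -[F x](subrK k) (le_trans (ler_normD _ _))// lerD2r.
have ic r : (@lebesgue_measure R).-integrable `]a, b] (EFin \o (fun _ : R => r)).
  by apply: (@integrable_itvoc _ _ _ _ `|r|).
have <- : \int[lebesgue_measure]_(x in `]a, b]) k = k * (b - a).
  by rewrite Rintegral_cst// fine_lebesgue_measure_oc.
have <- : \int[lebesgue_measure]_(x in `]a, b]) e = e * (b - a).
  by rewrite Rintegral_cst// fine_lebesgue_measure_oc.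
have iFk : (@lebesgue_measure R).-integrable `]a, b] (EFin \o (fun x => F x - k)).
  apply: (@integrable_itvoc _ _ _ _ e) => //.
  exact: measurable_funB.
rewrite -RintegralB//; apply: le_trans (le_normr_Rintegral _ _) _ => //.
apply: le_Rintegral => //.
  apply: (@integrable_itvoc _ _ _ _ e) => //.
    by apply: measurableT_comp => //; exact: measurable_funB.
  by move=> x xab; rewrite normr_id Fk.
Qed.

Lemma Rintegral_derive (R : realType) (F k : R -> R) (a b : R) : a <= b ->
    continuous F -> continuous k ->
    (forall x : R, a < x < b -> is_derive x 1 F (k x)) ->
  \int[lebesgue_measure]_(x in `]a, b]) k x = F b - F a.
Proof.
rewrite le_eqVlt => /predU1P[->|ab] cF ck dF.
  by rewrite set_itv_ge ?bnd_simp ?ltxx// Rintegral_set0 subrr.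
have ik : (@lebesgue_measure R).-integrable `]a, b] (EFin \o k).
  have icc : (@lebesgue_measure R).-integrable `[a, b] (EFin \o k).
    apply: continuous_compact_integrable; first exact: segment_compact.
    exact: continuous_subspaceT.
  by apply: integrableS icc => //; exact: subset_itv_oc_cc.
rewrite Rintegral_itv_obnd_cbnd// /Rintegral (@continuous_FTC2 _ k F a b ab)//; last 3 first.
- exact: continuous_subspaceT.
- split.
  + by move=> x; rewrite in_itv/= => /dF[].
  + by apply: cvg_within_filter; exact: cF.
  + by apply: cvg_within_filter; exact: cF.
- by move=> x; rewrite in_itv/= => /dF[_ kx]; rewrite derive1E.
Qed.

(** The form of the fundamental theorem of calculus that fits a wave started at
    the origin: [k0] is the derivative of [x |-> F (max 0 x)] away from 0. *)
Lemma Rintegral_derive_cut (R : realType) (F k k0 : R -> R) (C a b : R) : a <= b ->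
    continuous F -> continuous k ->
    (forall x : R, 0 < x -> is_derive x 1 F (k x)) ->
    measurable_fun setT k0 -> (forall x, `|k0 x| <= C) ->
    (forall x, 0 <= x -> k0 x = k x) -> (forall x, x < 0 -> k0 x = 0) ->
  \int[lebesgue_measure]_(x in `]a, b]) k0 x = F (Num.max 0 b) - F (Num.max 0 a).
Proof.
move=> ab cF ck dF mk0 k0C k0p k0n.
have itg x y : (@lebesgue_measure R).-integrable `]x, y] (EFin \o k0).
  by apply: (integrable_itvoc (C := C) mk0) => z _.
have pos x y : 0 <= x -> x <= y ->
    \int[lebesgue_measure]_(x in `]x, y]) k0 x = F y - F x.
  move=> x0 xy; have dFxy (z : R) : x < z < y -> is_derive z 1 F (k z).
    by move=> /andP[xz _]; apply: dF; exact: le_lt_trans xz.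
  rewrite -(Rintegral_derive xy cF ck dFxy).
  apply: eq_Rintegral => z; rewrite inE /= in_itv/= => /andP[xz _].
  by apply: k0p; rewrite (le_trans x0)// ltW.
have neg x y : x <= y -> y <= 0 -> \int[lebesgue_measure]_(x in `]x, y]) k0 x = 0.
  move=> xy y0; rewrite -Rintegral_itv_bndo_bndc; last first.
    by apply: integrableS (itg x y) => //; exact: subset_itv_oo_oc.
  transitivity (\int[lebesgue_measure]_(x in `]x, y[) (0 : R)).
    apply: eq_Rintegral => z; rewrite inE /= in_itv/= => /andP[_ zy].
    by apply: k0n; exact: lt_le_trans y0.
  by rewrite Rintegral_cst// mul0r.
have [b0|b0] := leP b 0.
  by rewrite neg// !max_l ?subrr// (le_trans ab).
have [a0|a0] := leP 0 a; first by rewrite pos.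
rewrite (@itv_bndbnd_setU _ _ _ (BRight 0)) ?bnd_simp ?(ltW a0) ?(ltW b0)//.
rewrite Rintegral_setU//; last 2 first.
- apply: integrableS (itg a b) => //; first exact: measurableU.
  move=> z /=; rewrite !in_itv/= => -[] /andP[z1 z2]; apply/andP; split=> //.
    by rewrite (le_trans z2)// ltW.
  by rewrite (lt_trans a0).
- rewrite disj_set2E; apply/eqP/seteqP; split => // z [] /=; rewrite !in_itv/=.
  by move=> /andP[_ z0] /andP[]; rewrite ltNge z0.
by rewrite neg ?(ltW a0)// add0r pos// ltW.
Qed.

(** * Measure solutions in terms of distribution functions *)

(** [V] is the right continuous representative of [U'] and [N] the distribution
    function of the control. The measure equation on half-open intervals says
    that [V + c U - N] is a primitive of [- f(U)]; the lower bound starts from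
    this fact. *)
Lemma measure_solution_dini (R : realType) (f : R -> R) (c M : R)
    (mu : {finite_measure set (measurableTypeR R) -> \bar R}) (U : R -> R) :
    continuous f -> (forall x, `|f (U x)| <= M) -> {homo U : x y / x <= y} ->
    measure_solution f c mu U ->
  exists V N : R -> R,
  [/\ continuous U /\ forall x, has_right_derivative U x (V x),
      forall x e, 0 < e -> exists2 d, 0 < d &
        forall h, 0 <= h <= d -> `|V (x + h) - V x| <= e,
      {homo N : x y / x <= y} /\ forall x, 0 <= N x <= fine (mu setT),
      continuous (fun x => V x + c * U x - N x)
    & forall x, has_right_derivative (fun x => V x + c * U x - N x) x (- f (U x))].
Proof.
move=> fc fUM hU [g [h [UV muE]]].
pose V x := g x - h x; pose N x := fine (mu `]-oo, x]%classic).
have mT (A : set R) : measurable (A : set (measurableTypeR R)) -> mu A \is a fin_num.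
  by move=> mA; exact: fin_num_measure.
have NB a b : a <= b -> N b - N a = fine (mu `]a, b]%classic).
  move=> ab; rewrite /N.
  have -> : `]-oo, b]%classic = (`]-oo, a] `|` `]a, b])%classic.
    by rewrite -itv_bndbnd_setU// bnd_simp.
  rewrite measureU//.
    by rewrite fineD ?mT// addrAC subrr add0r.
  by apply/seteqP; split => //= x []; rewrite /= !in_itv/=; case: ltP.
have mV : measurable_fun setT V.
  by apply: measurable_funB; apply: nondecreasing_measurable => //;
    exact: cumulative_is_nondecreasing.
have mfU : measurable_fun setT (f \o U).
  apply: measurableT_comp; first exact: continuous_measurable_fun.
  exact: nondecreasing_measurable.
have Vb a b x : a <= x <= b -> `|V x| <= `|g a| + `|g b| + `|h a| + `|h b|.
  move=> /andP[ax xb].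
  have := cumulative_is_nondecreasing g _ _ ax; have := cumulative_is_nondecreasing g _ _ xb.
  have := cumulative_is_nondecreasing h _ _ ax; have := cumulative_is_nondecreasing h _ _ xb.
  have := ler_norm (g b); have := ler_norm (- g a); have := ler_norm (- h a).
  have := ler_norm (h b); rewrite !normrN.
  have := normr_ge0 (g a); have := normr_ge0 (h a); have := normr_ge0 (g b).
  by have := normr_ge0 (h b); rewrite /V ler_norml; lra.
have UE a b : a <= b -> U b - U a = \int[lebesgue_measure]_(x in `]a, b]) V x.
  move=> ab; rewrite UV// (Rintegral_itvcc_oc mV (C := `|g a| + `|g b| + `|h a| + `|h b|))//.
  by move=> x /andP[ax xb]; apply: Vb; rewrite ltW.
have ZE a b : a <= b -> (V b + c * U b - N b) - (V a + c * U a - N a) =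
    - \int[lebesgue_measure]_(x in `]a, b]) f (U x).
  move=> ab; have bab : bounded_set (`]a, b]%classic : set R).
    exists (`|a| + `|b|); split; first exact: num_real.
    move=> C CC x /=; rewrite in_itv/= => /andP[ax xb].
    rewrite (le_trans _ (ltW CC))//.
    have := ler_norm b; have := ler_norm (- a); rewrite normrN.
    have := normr_ge0 a; have := normr_ge0 b.
    by rewrite ler_norml; lra.
  have := muE _ (measurable_itv `]a, b]) bab.
  rewrite -NB// -UE// /lebesgue_stieltjes_measure /= /measure_extension /=.
  rewrite !measurable_mu_extE/= ?wlength_itv_bnd//; try exact: is_ocitv.
  by rewrite /V /=; lra.
exists V, N.
have Vrc x e : 0 < e -> exists2 d, 0 < d & forall h, 0 <= h <= d -> `|V (x + h) - V x| <= e.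
  move=> e0; have e20 : 0 < e / 2 by rewrite divr_gt0.
  have [d d0 Hd] := right_continuous_estimate (cumulative_is_right_continuous g x) e20.
  have [d' d'0 Hd'] := right_continuous_estimate (cumulative_is_right_continuous h x) e20.
  exists (Num.min d d'); first by rewrite lt_min d0.
  move=> k; rewrite le_min => /and3P[k0 kd kd'].
  have := Hd k; have := Hd' k; rewrite k0 kd kd' => /(_ isT) + /(_ isT).
  by rewrite /V !ler_norml; lra.
split => //.
- split=> x.
    apply: locally_lipschitz_continuous ltr01 _ => a b xa ab bx.
    rewrite UE// -[X in `|X|]subr0 -(mul0r (b - a)).
    apply: (Rintegral_near_cst ab mV) => y /andP[ay yb]; rewrite subr0.
    by apply: (Vb (x - 1) (x + 1)); apply/andP; split; lra.
  move=> e e0; have [d d0 Hd] := Vrc x e e0; exists d => // k /andP[k0 kd].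
  have xk : x <= x + k by rewrite lerDl.
  have kE : k = x + k - x by ring.
  rewrite UE// {2 3}kE; apply: (Rintegral_near_cst xk mV) => y /andP[xy yk].
  have -> : y = x + (y - x) by ring.
  by apply: Hd; apply/andP; split; lra.
- split; first by move=> x y xy; rewrite -subr_ge0 NB// fine_ge0.
  move=> x; rewrite fine_ge0//=; apply: fine_le; rewrite ?mT//.
  by apply: le_measure; rewrite ?inE.
- move=> x; apply: locally_lipschitz_continuous ltr01 _ => a b xa ab bx.
  rewrite ZE// normrN -[X in `|X|]subr0 -(mul0r (b - a)).
  by apply: (Rintegral_near_cst ab mfU) => y _; rewrite subr0 /=; exact: fUM.
- move=> x e e0; have [d1 d10 Hd1] := continuous_estimate (fc (U x)) e0.
  have [d d0 Hd] : exists2 d, 0 < d & forall k, 0 <= k <= d -> `|U (x + k) - U x| <= d1.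
    apply: right_continuous_estimate d10.
    apply: cvg_within_filter.
    apply: locally_lipschitz_continuous ltr01 _ => a b xa ab bx.
    rewrite UE// -[X in `|X|]subr0 -(mul0r (b - a)).
    apply: (Rintegral_near_cst ab mV) => y /andP[ay yb]; rewrite subr0.
    by apply: (Vb (x - 1) (x + 1)); apply/andP; split; lra.
  exists d => // k /andP[k0 kd].
  have xk : x <= x + k by rewrite lerDl.
  have kE : k = x + k - x by ring.
  rewrite ZE// {2 3}kE mulNr -opprD normrN.
  apply: (Rintegral_near_cst xk mfU) => y /andP[xy yk] /=.
  have -> : y = x + (y - x) by ring.
  by apply: Hd1; apply: Hd; apply/andP; split; lra.
Qed.

Lemma lebesgue_stieltjes_oc (R : realType) (g : cumulative R R) (a b : R) :
  a <= b -> lebesgue_stieltjes_measure g `]a, b]%classic = (g b - g a)%:E.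
Proof.
move=> ab; rewrite /lebesgue_stieltjes_measure /= /measure_extension /=.
by rewrite measurable_mu_extE/= ?wlength_itv_bnd//; exact: is_ocitv.
Qed.

(** Both sides are measures, so that half-open intervals suffice. *)
Lemma lebesgue_stieltjes_density (R : realType) (g : cumulative R R) (F : R -> R)
    (mu : {measure set (measurableTypeR R) -> \bar R}) :
    measurable_fun setT F -> (forall x, 0 <= F x) ->
    (forall a b : R, a <= b ->
      ((g b - g a)%:E = \int[lebesgue_measure]_(x in `]a, b]) (F x)%:E
                        + mu `]a, b]%classic)%E) ->
  forall A : set (measurableTypeR R), measurable A ->
    (lebesgue_stieltjes_measure g A =
       \int[lebesgue_measure]_(x in A) (F x)%:E + mu A)%E.
Proof.
move=> mF F0 gE.
pose nu (A : set (measurableTypeR R)) := (\int[lebesgue_measure]_(x in A) (F x)%:E)%E.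
have nu0 : nu set0 = 0%E by exact: integral_set0.
have nu_ge0 A : (0 <= nu A)%E by apply: integral_ge0 => x _; rewrite lee_fin.
have nu_add : semi_sigma_additive nu.
  by apply: semi_sigma_additive_nng_induced => //; exact/measurable_EFinP.
pose nuM := isMeasure.Build _ _ _ nu nu0 nu_ge0 nu_add.
pose m : {measure set (measurableTypeR R) -> \bar R} := HB.pack nu nuM.
move=> A mA; have -> : (\int[lebesgue_measure]_(x in A) (F x)%:E + mu A)%E =
    measure_add m mu A by rewrite measure_addE.
apply: lebesgue_stieltjes_measure_unique => //.
move=> X /ocitvP[->|[[a b] /= ab ->]]; first by rewrite !measure0.
by rewrite [RHS](measure_addE m mu) lebesgue_stieltjes_oc ?gE// ltW.
Qed.

(** It suffices to check the equation on half-open intervals. The decomposition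
    of the signed measure [V'] into positive parts is obtained by adding the
    linear function [L x], with [L] a bound on the density of [V']: then
    [V + L x] is nondecreasing. *)
Lemma measure_solution_itv (R : realType) (f : R -> R) (c M C : R)
    (mu : {finite_measure set (measurableTypeR R) -> \bar R}) (U V : R -> R) :
    continuous f -> (forall x, `|f (U x)| <= M) -> measurable_fun setT U ->
    measurable_fun setT V -> (forall x, `|V x| <= C) ->
    (forall x, V @ at_right x --> V x) ->
    (forall a b, a <= b -> U b - U a = \int[lebesgue_measure]_(x in `]a, b]) V x) ->
    (forall a b, a <= b -> V b - V a =
       \int[lebesgue_measure]_(x in `]a, b]) (- c * V x - f (U x)) +
       fine (mu `]a, b]%classic)) ->
  measure_solution f c mu U.
Proof.
move=> fc fUM mU mV VC Vrc UE VE.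
have mfU : measurable_fun setT (f \o U).
  by apply: measurableT_comp => //; exact: continuous_measurable_fun.
have mcV : measurable_fun setT (fun x => - c * V x).
  by apply: measurable_funM => //; exact: measurable_cst.
pose a x := - c * V x - f (U x).
have ma : measurable_fun setT a by exact: measurable_funB.
pose L := `|c| * C + M.
have aL x : `|a x| <= L.
  rewrite (le_trans (ler_normB _ _))// lerD// normrM normrN.
  by rewrite ler_wpM2l.
have L0 : 0 <= L := le_trans (normr_ge0 _) (aL 0).
have La0 x : 0 <= L + a x by have := aL x; rewrite ler_norml; lra.
have mLa : measurable_fun setT (fun x => L + a x).
  by apply: measurable_funD => //; exact: measurable_cst.
have bounded_integrable (A : set (measurableTypeR R)) (F : R -> R) (B : R) :
    measurable A -> (lebesgue_measure A < +oo)%E ->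
    measurable_fun setT F -> (forall x, `|F x| <= B) ->
    (@lebesgue_measure R).-integrable A (EFin \o F).
  move=> mA Afin mF FB; apply: measurable_bounded_integrable => //.
    exact: measurable_funS mF.
  exists B; split; first exact: num_real.
  by move=> D BD x _ /=; rewrite (le_trans (FB x))// ltW.
have LaE (A : set (measurableTypeR R)) : measurable A -> (lebesgue_measure A < +oo)%E ->
    \int[lebesgue_measure]_(x in A) (L + a x) =
    L * fine (lebesgue_measure A) + \int[lebesgue_measure]_(x in A) a x.
  move=> mA Afin; rewrite RintegralD//.
  - by rewrite Rintegral_cst.
  - exact: (bounded_integrable _ _ `|L|).
  - exact: (bounded_integrable _ _ L).
have LaE' (A : set (measurableTypeR R)) : measurable A -> (lebesgue_measure A < +oo)%E ->
    (\int[lebesgue_measure]_(x in A) (L + a x)%:E =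
    (L * fine (lebesgue_measure A) + \int[lebesgue_measure]_(x in A) a x)%:E)%E.
  move=> mA Afin; rewrite -LaE// /Rintegral fineK//.
  apply: (integrable_fin_num mA).
  apply: (bounded_integrable _ _ (L + L)) => // x.
  by rewrite (le_trans (ler_normD _ _))// lerD// ger0_norm.
have itvfin (x y : R) : (@lebesgue_measure R `]x, y]%classic < +oo)%E.
  by rewrite lebesgue_measure_itv/=; case: ifPn => // _; rewrite -EFinB ltry.
have muN (x y : R) : x <= y -> (mu `]x, y]%classic = (fine (mu `]x, y]%classic))%:E)%E.
  by move=> xy; rewrite fineK//; apply: fin_num_measure; exact: measurable_itv.
pose G x := V x + L * x.
have GE x y : x <= y -> G y - G x = L * (y - x) + (V y - V x) by rewrite /G; lra.
have Gnd : nondecreasing G.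
  move=> x y xy; rewrite -subr_ge0 GE// VE// addrA addr_ge0//.
    have <- : fine (@lebesgue_measure R `]x, y]) = y - x by exact: fine_lebesgue_measure_oc.
    by rewrite -LaE//; apply: Rintegral_ge0 => z _.
  by rewrite fine_ge0.
have Grc x : G @ at_right x --> G x.
  apply: cvgD; first exact: Vrc.
  by apply: cvg_within_filter; apply: cvgM; [exact: cvg_cst|exact: cvg_id].
have Hnd : nondecreasing (fun x : R => L * x).
  by move=> x y xy; rewrite ler_wpM2l.
have Hrc (x : R) : (fun x : R => L * x) @ at_right x --> L * x.
  by apply: cvg_within_filter; apply: cvgM; [exact: cvg_cst|exact: cvg_id].
pose Gm := isCumulative.Build R _ R G Gnd Grc.
pose Hm := isCumulative.Build R _ R (fun x : R => L * x) Hnd Hrc.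
pose g : cumulative R R := HB.pack G Gm.
pose h : cumulative R R := HB.pack (fun x : R => L * x) Hm.
exists g, h; rewrite /=.
have -> : (fun x => G x - L * x) = V by apply/funext => x; rewrite /G addrK.
split.
  move=> x y xy; rewrite UE//; symmetry; apply: (Rintegral_itvcc_oc (C := C)) => //.
move=> A mA [B [_ bA]].
have Afin : (lebesgue_measure A < +oo)%E.
  have AB : A `<=` `]- (`|B| + 1) - 1, `|B| + 1]%classic.
    move=> x /bA -/(_ (`|B| + 1)); rewrite /= in_itv/= ler_norml => H.
    have := ler_norm B; lra.
  apply: le_lt_trans (itvfin (- (`|B| + 1) - 1) (`|B| + 1)).
  by apply: le_measure; rewrite ?inE.
rewrite (lebesgue_stieltjes_density (g := g) (mu := mu) mLa)//; last first.
  move=> x y xy; rewrite LaE'// [X in (_ + X)%E](muN _ _ xy) -EFinD; congr (_%:E).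
  by rewrite GE// VE// fine_lebesgue_measure_oc// addrA.
rewrite (lebesgue_stieltjes_density (g := h) (F := fun _ => L) (mu := mzero)) //; last first.
  move=> x y xy; rewrite adde0 integral_cst//=.
  have -> : (lebesgue_measure `]x, y]%classic = (y - x)%:E :> \bar R)%E.
    by rewrite -fine_lebesgue_measure_oc// fineK// ge0_fin_numE.
  by rewrite -EFinM; congr (_%:E); ring.
rewrite LaE'// integral_cst//= /mzero adde0 fineD//; last exact: fin_num_measure.
rewrite fineM//; last by rewrite ge0_fin_numE.
rewrite /= /a RintegralB//; last 2 first.
- apply: (bounded_integrable _ _ (`|c| * C)) => // x.
  by rewrite normrM normrN ler_wpM2l.
- exact: (bounded_integrable _ _ M).
rewrite RintegralZl//; last exact: (bounded_integrable _ _ C).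
by ring.
Qed.

(** * Every control costs at least the profile at zero *)

Lemma from0to1_near (R : realType) (U : R -> R) : from0to1 U ->
  forall e, 0 < e -> exists2 A, 0 < A &
    (forall x, A <= x -> `|U x - 1| <= e) /\ (forall x, x <= - A -> `|U x| <= e).
Proof.
move=> [U0 U1] e e0.
have /cvgrPdist_le/(_ e e0)[a [_ Ha]] := U0.
have /cvgrPdist_le/(_ e e0)[b [_ Hb]] := U1.
exists (`|a| + `|b| + 1); first by have := normr_ge0 a; have := normr_ge0 b; lra.
have := normr_ge0 a; have := normr_ge0 b.
have := ler_norm (- a); have := ler_norm b; rewrite normrN => *.
split=> x hx.
  by rewrite distrC; apply: Hb; lra.
by rewrite -normrN -sub0r; apply: Ha; lra.
Qed.

Lemma from0to1_itv (R : realType) (U : R -> R) :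
  {homo U : x y / x <= y} -> from0to1 U -> forall x, 0 <= U x <= 1.
Proof.
move=> Und U01 x; apply/andP; split.
  rewrite leNgt; apply/negP => Ux.
  have e0 : 0 < - U x / 2 by rewrite divr_gt0// oppr_gt0.
  have [A A0 [_ HA]] := from0to1_near U01 e0.
  have := HA (Num.min x (- A)); rewrite ge_min lexx orbT => /(_ isT).
  have : U (Num.min x (- A)) <= U x by apply: Und; rewrite ge_min lexx.
  by rewrite ler_norml; lra.
rewrite leNgt; apply/negP => Ux.
have e0 : 0 < (U x - 1) / 2 by rewrite divr_gt0// subr_gt0.
have [A A0 [HA _]] := from0to1_near U01 e0.
have := HA (Num.max x A); rewrite le_max lexx orbT => /(_ isT).
have : U x <= U (Num.max x A) by apply: Und; rewrite le_max lexx.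
by rewrite ler_norml; lra.
Qed.

Section LowerBound.
Variables (R : realType) (f P U V N : R -> R) (c : R).
Hypothesis hf : monostable f.
Hypothesis hP : profile f c P.
Hypothesis P0 : 0 < P 0.
Hypothesis Und : {homo U : x y / x <= y}.
Hypothesis U01 : from0to1 U.
Hypothesis cU : continuous U.
Hypothesis dU : forall x, has_right_derivative U x (V x).
Hypothesis Nnd : {homo N : x y / x <= y}.
Hypothesis cZ : continuous (fun x => V x + c * U x - N x).
Hypothesis dZ : forall x,
  has_right_derivative (fun x => V x + c * U x - N x) x (- f (U x)).

Let Uitv := from0to1_itv Und U01.

Lemma slope_ge0 x : 0 <= V x.
Proof.
rewrite leNgt; apply/negP => Vx.
have e0 : 0 < - V x / 2 by rewrite divr_gt0// oppr_gt0.
have [d d0 Hd] := dU x e0.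
have := Hd d; rewrite lexx ltW// => /(_ isT).
have : U x <= U (x + d) by apply: Und; rewrite lerDl ltW.
have : V x * d < 0 by rewrite nmulr_rlt0.
by rewrite ler_norml; lra.
Qed.

(** A monotone wave that has reached 1 is constant from there on. *)
Lemma slope_top x : U x = 1 -> V x = 0.
Proof.
move=> Ux; apply/le_anti; rewrite slope_ge0 andbT.
apply/ler_addgt0Pr => e e0; rewrite add0r.
have [d d0 Hd] := dU x e0; have := Hd d; rewrite lexx ltW// => /(_ isT).
have -> : U (x + d) = 1.
  have /andP[_ U1] := Uitv (x + d); apply/le_anti; rewrite U1 -Ux.
  by apply: Und; rewrite lerDl ltW.
by rewrite Ux subrr sub0r normrN normrM (gtr0_norm d0) ler_pM2r// ger0_norm// slope_ge0.
Qed.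

Let H x := - (V x + c * U x - N x) + (c * U x + P (U x)).

Let HE x : N x - H x = V x - P (U x).
Proof. by rewrite /H; ring. Qed.

Let profile_pos u : 0 <= u < 1 -> 0 < P u.
Proof.
case: hP => _ _ _ Pp _ /andP[u0 u1].
by have [->//|un0] := eqVneq u 0; apply: Pp; rewrite u1 lt_neqAle eq_sym un0 u0.
Qed.

Let cH : continuous H.
Proof.
case: hP => cP _ _ _ _ x.
have cPU : {for x, continuous (P \o U)} by apply: continuous_comp; [exact: cU|exact: cP].
apply: cvgD; first by apply: cvgN; exact: cZ.
by apply: cvgD; [apply: cvgM; [exact: cvg_cst|exact: cU]|exact: cPU].
Qed.

Let dH x : U x < 1 -> has_right_derivative H x (f (U x) * (1 - V x / P (U x))).
Proof.
case: hP => _ _ _ _ dP Ux; have /andP[U0 _] := Uitv x.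
have Ux01 : 0 <= U x < 1 by rewrite U0.
have PU := profile_pos Ux01.
have dPU := has_right_derivative_comp (dP _ Ux01 PU) (dU x).
have d1 := has_right_derivativeZ (-1) (dZ x).
have d2 := has_right_derivativeD (has_right_derivativeZ c (dU x)) dPU.
have -> : H = (fun x => -1 * (V x + c * U x - N x) + (c * U x + (P \o U) x)).
  by apply/funext => y; rewrite /H mulN1r.
have -> : f (U x) * (1 - V x / P (U x)) =
    -1 * - f (U x) + (c * V x + (- c - f (U x) / P (U x)) * V x) by ring.
exact: has_right_derivativeD d1 d2.
Qed.

Let fU_ge0 x : 0 <= f (U x). Proof. exact: (monostable_ge0 hf). Qed.

(** Write [V - P(U) = N - H]. Then [H' = f(U) (1 - V / P(U))] is nonpositive
    while [V > P(U)], so that an excess of slope would persist forever; this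
    would bound [V] from below by a positive constant and make [U] unbounded. *)
Lemma slope_le_profile x : V x <= P (U x).
Proof.
rewrite leNgt; apply/negP => Vx.
pose w := V x - P (U x); have w0 : 0 < w by rewrite subr_gt0.
have P_ge0 y : 0 <= P (U y).
  have /andP[U0 U1] := Uitv y; have [Uy|Uy] := eqVneq (U y) 1.
    by rewrite Uy; case: hP => _ ->.
  by apply/ltW/profile_pos; rewrite U0 lt_neqAle Uy.
have Vw b : x <= b -> w <= V b.
  move=> xb; have := @gap_persists _ N H x b xb (fun y z _ yz _ => Nnd yz) (fun y _ => @cH y).
  rewrite !HE => /(_ w0) E; suff : w <= V b - P (U b) by have := P_ge0 b; lra.
  apply: E => y _; rewrite HE => wy.
  have Uy : U y < 1.
    rewrite lt_neqAle; have /andP[_ ->] := Uitv y; rewrite andbT; apply/eqP => Uy.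
    by move: wy; rewrite (slope_top Uy); have := P_ge0 y; lra.
  exists (f (U y) * (1 - V y / P (U y))); last exact: dH.
  have PU : 0 < P (U y) by apply: profile_pos; have /andP[-> _] := Uitv y.
  rewrite mulr_ge0_le0// subr_le0 ler_pdivlMr// mul1r; lra.
(* at slope w the wave climbs by 2 up to b *)
pose b := x + 2 / w.
have xb : x <= b by rewrite lerDl divr_ge0// ltW.
have := @right_derivative_nonincreasing _ (fun y => w * y + -1 * U y) x b xb _ _.
have -> : w * b + -1 * U b = w * x + 2 - U b.
  by rewrite /b; field; rewrite gt_eqF.
have := Uitv b; have := Uitv x => Ux Ub E.
suff : w * x + 2 - U b <= w * x + -1 * U x by lra.
apply: E => y /andP[xy _].
  by apply: cvgD; apply: cvgM; [exact: cvg_cst|exact: cvg_id|exact: cvg_cst|exact: cU].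
exists (w * 1 + -1 * V y); first by have := Vw y xy; lra.
apply: has_right_derivativeD; last exact: has_right_derivativeZ.
apply: has_right_derivativeZ; apply: is_derive_right; exact: is_derive_id.
Qed.

(** Now that [V <= P(U)], the same [H] is nondecreasing, and
    [N = H + V - P(U)]. *)
Lemma cost_between a b : a <= b -> U b < 1 ->
  P (U a) - V a - P (U b) <= N b - N a.
Proof.
move=> ab Ub; have Vb := slope_ge0 b.
have Hab : H a <= H b.
  have := @right_derivative_nonincreasing _ (fun y => -1 * H y) a b ab _ _.
  move=> E; suff : -1 * H b <= -1 * H a by lra.
  apply: E => y /andP[ay yb].
    by apply: cvgM; [exact: cvg_cst|exact: cH].
  have Uy : U y < 1 by apply: le_lt_trans Ub; apply: Und; exact: ltW.
  exists (-1 * (f (U y) * (1 - V y / P (U y)))); last exact/has_right_derivativeZ/dH.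
  have PU : 0 < P (U y) by apply: profile_pos; have /andP[-> _] := Uitv y.
  rewrite mulN1r oppr_le0 mulr_ge0// subr_ge0 ler_pdivrMr// mul1r.
  exact: slope_le_profile.
by have := HE a; have := HE b; lra.
Qed.

(** A slope bounded from below on an interval of length one would make [U]
    vary more than it can near [-oo]. *)
Lemma slope_small e A : 0 < e -> exists a, [/\ a <= A, U a <= e & V a <= e].
Proof.
move=> e0; have e20 : 0 < e / 2 by rewrite divr_gt0.
have [B B0 [_ HB]] := from0to1_near U01 e20.
pose a := Num.min A (- B).
have aB x : x <= a -> `|U x| <= e / 2.
  by move=> xa; apply: HB; rewrite (le_trans xa)// ge_min lexx orbT.
have aA : a <= A by rewrite ge_min lexx.
suff [x [ax xa Vx]] : exists x, [/\ a - 1 <= x, x <= a & V x <= e].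
  exists x; split=> //; first exact: le_trans aA.
  by have := aB x xa; rewrite ler_norml; lra.
apply: contrapT => Vbig.
have ab : a - 1 <= a by lra.
have := @right_derivative_nonincreasing _ (fun y => e * y + -1 * U y) (a - 1) a ab _ _.
have := Uitv (a - 1); have := aB a (lexx _); rewrite ler_norml => Ua Ua1 E.
suff : e * a + -1 * U a <= e * (a - 1) + -1 * U (a - 1) by lra.
apply: E => y /andP[ay ya].
  by apply: cvgD; apply: cvgM; [exact: cvg_cst|exact: cvg_id|exact: cvg_cst|exact: cU].
exists (e * 1 + -1 * V y).
  have : e < V y by rewrite ltNge; apply/negP => Vy; apply: Vbig; exists y; rewrite ay ltW.
  by lra.
apply: has_right_derivativeD; last exact: has_right_derivativeZ.
apply: has_right_derivativeZ; apply: is_derive_right; exact: is_derive_id.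
Qed.

(** [cost_between] with [U a] near 0, [V a] near 0 and [U b] near 1. *)
Lemma cost_ge (m : R) : (forall x, 0 <= N x <= m) -> P 0 <= m.
Proof.
move=> Nm; apply/ler_addgt0Pr => e e0.
have e30 : 0 < e / 3%:R by rewrite divr_gt0.
case: hP => cP P1 _ _ _.
have [d d0 Hd] := continuous_estimate (cP 1) e30.
have [d' d'0 Hd'] := continuous_estimate (cP 0) e30.
pose v := 1 - Num.min d (1 / 2).
have [v1 dv] : 1 / 2 <= v < 1 /\ `|v - 1| <= d.
  have m0 : 0 < Num.min d (1 / 2) by rewrite lt_min d0 divr_gt0.
  have md : Num.min d (1 / 2) <= d by rewrite ge_min lexx.
  have m2 : Num.min d (1 / 2) <= 1 / 2 by rewrite ge_min lexx orbT.
  by split; [rewrite /v; lra|rewrite ler_norml /v; lra].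
have [b Ub] : exists b, U b = v.
  have mv : 0 < Num.min (1 / 2) (1 - v) by rewrite lt_min; lra.
  have [A A0 [HA1 HA0]] := from0to1_near U01 mv.
  have mv1 : Num.min (1 / 2) (1 - v) <= 1 / 2 by rewrite ge_min lexx.
  have mv2 : Num.min (1 / 2) (1 - v) <= 1 - v by rewrite ge_min lexx orbT.
  have AA : - A <= A by lra.
  have UA := HA1 A (lexx _); have UA' := HA0 (- A) (lexx _).
  have [|x _ Ux] := IVT (v := v) AA (continuous_subspaceT cU); last by exists x.
  move: UA UA'; rewrite !ler_norml => UA UA'.
  by rewrite ge_min le_max; apply/andP; split; apply/orP; [left|right]; lra.
have md' : 0 < Num.min d' (e / 3%:R) by rewrite lt_min d'0.
have [a [ab Ua Va]] := slope_small b md'.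
have Ub1 : U b < 1 by rewrite Ub; lra.
have := cost_between ab Ub1; have := Nm a; have := Nm b.
have := Hd v dv; rewrite -Ub P1 subr0.
have : Num.min d' (e / 3%:R) <= e / 3%:R by rewrite ge_min lexx orbT.
have : `|P (U a) - P 0| <= e / 3%:R.
  apply: Hd'; have /andP[U0 _] := Uitv a; rewrite subr0 ger0_norm//.
  by rewrite (le_trans Ua)// ge_min lexx.
by rewrite !ler_norml; lra.
Qed.

End LowerBound.

Lemma admissible_ge_profile (R : realType) (f P : R -> R) (c : R) mu :
  monostable f -> profile f c P -> admissible f c mu -> P 0 <= fine (mu setT).
Proof.
move=> hf hP [U [Und U01 Umu]].
have cf := monostable_continuous hf.
have Uitv := from0to1_itv Und U01.
have [M M0 fM] := monostable_le_linear hf.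
have fUM x : `|f (U x)| <= M.
  rewrite ger0_norm ?(monostable_ge0 hf)// (le_trans (fM _ (Uitv x)))// ger_pMr//.
  by have := Uitv x; lra.
have [P0|P0] := leP (P 0) 0; first by rewrite (le_trans P0)// fine_ge0.
have [V [N [[cU dU] Vrc [Nnd Nmu] cZ dZ]]] := measure_solution_dini cf fUM Und Umu.
exact: (cost_ge hf hP P0 Und U01 cU dU Nnd cZ dZ Nmu).
Qed.

(** * Waves that follow the profile *)

Lemma from0to1P (R : realType) (U : R -> R) :
    {homo U : x y / x <= y} -> (forall x, 0 <= U x <= 1) ->
    (forall e, 0 < e -> exists A, U A <= e) ->
    (forall e, 0 < e -> exists A, 1 - e <= U A) ->
  from0to1 U.
Proof.
move=> Und Uitv U0 U1; split; apply/cvgrPdist_le => e e0.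
  have [A UA] := U0 e e0; exists A; split; first exact: num_real.
  move=> x xA; have := Und x A (ltW xA); have := Uitv x.
  by rewrite ler_norml; lra.
have [A UA] := U1 e e0; exists A; split; first exact: num_real.
move=> x xA; have := Und A x (ltW xA); have := Uitv x.
by rewrite ler_norml; lra.
Qed.

Section AutonomousFlow.
Variables (R : realType) (b y : R -> R) (K y0 : R).
Hypothesis cb : continuous b.
Hypothesis b_ge0 : forall u, 0 <= b u.
Hypothesis b_gt0 : forall u, y0 <= u < 1 -> 0 < b u.
Hypothesis b_le : forall u, y0 <= u <= 1 -> b u <= K * (1 - u).
Hypothesis y0lt1 : y0 < 1.
Hypothesis yE : y 0 = y0.
Hypothesis dy : forall x : R, is_derive x 1 y (b (y x)).

Lemma flow_nondecreasing : {homo y : s t / s <= t}.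
Proof. by move=> s t st; exact: derive_ge0_le st dy _. Qed.

Let cy : continuous y.
Proof. by move=> x; exact: is_derive_continuous_at (dy x). Qed.

(** [(1 - y) exp (K x)] is nondecreasing as long as [y <= 1], hence [y] cannot
    reach 1 in finite time. *)
Lemma flow_lt1 x : 0 <= x -> y0 <= y x < 1.
Proof.
move=> x0; have yx : y0 <= y x by rewrite -yE flow_nondecreasing.
rewrite yx/= ltNge; apply/negP => y1.
have [|t] := IVT (v := 1) x0 (continuous_subspaceT cy).
  by rewrite yE ge_min le_max (ltW y0lt1) y1 orbT.
rewrite in_itv/= => /andP[t0 tx] yt.
pose E s := (1 - y s) * expR (K * s).
have dE (s : R) : is_derive s 1 E ((K * (1 - y s) - b (y s)) * expR (K * s)).
  have d1 : is_derive s 1 (fun s => 1 - y s) (0 - b (y s)).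
    exact: is_deriveB.
  have dK : is_derive s 1 (K \*: id) (K *: (1 : R)) by apply: is_deriveZ; exact: is_derive_id.
  have d2 := @is_derive1_comp R expR (K \*: id) s _ _ (is_derive_expR _) dK.
  have d3 := is_deriveM d1 d2.
  by apply: (is_derive_eq d3); rewrite /GRing.scale /=; ring.
have : E 0 <= E t.
  apply: derive_ge0_le t0 dE _ => s /andP[s0 st].
  apply: mulr_ge0; last exact: expR_ge0.
  rewrite subr_ge0; apply: b_le; apply/andP; split.
    by rewrite -yE; exact: flow_nondecreasing.
  by rewrite -yt; exact: flow_nondecreasing.
by rewrite /E yt subrr mul0r mulr0 expR0 mulr1 yE subr_le0 leNgt y0lt1.
Qed.

(** Below a level [v < 1] the speed [b] has a positive minimum. *)
Lemma flow_cvg1 e : 0 < e -> exists A, forall x, A <= x -> 1 - e <= y x.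
Proof.
move=> e0; pose v := Num.max y0 (1 - e).
have v1 : v < 1 by rewrite gt_max y0lt1/=; lra.
have yv : y0 <= v by rewrite le_max lexx.
have ev : 1 - e <= v by rewrite le_max lexx orbT.
have [u /[!in_itv]/= /andP[y0u uv] bu] := EVT_min yv (continuous_subspaceT cb).
have m0 : 0 < b u by apply: b_gt0; rewrite y0u (le_lt_trans uv).
suff [A A0 vA] : exists2 A, 0 <= A & v <= y A.
  by exists A => x Ax; rewrite (le_trans ev)// (le_trans vA)// flow_nondecreasing.
apply: contrapT => nA.
have yltv x : 0 <= x -> y x < v.
  by move=> x0; rewrite ltNge; apply/negP => vx; apply: nA; exists x.
pose A := (v - y0) / b u + 1.
have A0 : 0 < A by rewrite ltr_wpDl// divr_ge0 ?(ltW m0)// subr_ge0.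
have [x /andP[x0 xA]] := mean_value A0 dy; rewrite yE subr0 => E.
have : b u <= b (y x).
  apply: bu; rewrite in_itv/=; have /andP[-> _] := flow_lt1 (ltW x0).
  by rewrite ltW// yltv// ltW.
move=> /(ler_wpM2r (ltW A0)); rewrite -E {1}/A mulrDr mulr1 mulrC divfK ?gt_eqF//.
by have := yltv A (ltW A0); lra.
Qed.

End AutonomousFlow.

Lemma profile_flow (R : realType) (f P : R -> R) (c y0 : R) :
    monostable f -> profile f c P ->
  exists2 U : R -> R, U 0 = y0 & forall x : R, is_derive x 1 U (P (clamp 1 (U x))).
Proof.
move=> hf hP; have [K K0 PK] := profile_le_linear hf hP.
have [cP P1 P0 Pp _] := hP.
have [||||U U0 dU] := @peano_sum _ (cst 0) (P \o @clamp R 1) 0 K 0 y0.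
- by move=> x; exact: cvg_cst.
- by move=> x; apply: continuous_comp; [exact: clamp_continuous|exact: cP].
- by move=> x; rewrite normr0.
- move=> u /=; have := clamp_itv u (@ler01 R); set v := clamp 1 u => v01.
  rewrite ger0_norm; last first.
    have [->//|v0] := eqVneq v 0; have [->|v1] := eqVneq v 1; first by rewrite P1.
    by apply/ltW/Pp; rewrite !lt_neqAle eq_sym v0 v1.
  by rewrite (le_trans (PK v v01))// ger_pMr//; lra.
by exists U => // x; apply: (is_derive_eq (dU x)); rewrite /= add0r.
Qed.

Lemma profile_clamp_ge0 (R : realType) (f P : R -> R) (c u : R) :
  profile f c P -> 0 <= P (clamp 1 u).
Proof.
move=> [_ P1 P0 Pp _]; have := clamp_itv u (@ler01 R); set v := clamp 1 u => v01.
have [->//|v0] := eqVneq v 0; have [->|v1] := eqVneq v 1; first by rewrite P1.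
by apply/ltW/Pp; rewrite !lt_neqAle eq_sym v0 v1.
Qed.

Lemma profile_slope_derive (R : realType) (f P U : R -> R) (c x : R) :
    profile f c P -> 0 <= U x < 1 -> 0 < P (U x) -> is_derive x 1 U (P (U x)) ->
  is_derive x 1 (P \o U) (- c * P (U x) - f (U x)).
Proof.
move=> [_ _ _ _ dP] Ux PU dU.
have d := @is_derive1_comp R P U x _ _ (dP _ Ux PU) dU.
by apply: (is_derive_eq d); field; rewrite gt_eqF.
Qed.

(** The wave through [1 / 2]; its behaviour at [-oo] is that of the reflected
    flow [1 - U (- x)] at [+oo]. *)
Lemma profile_wave (R : realType) (f P : R -> R) (c : R) :
    monostable f -> profile f c P -> P 0 = 0 ->
  exists U : R -> R, [/\ {homo U : x y / x <= y}, from0to1 U,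
    forall x, 0 < U x < 1 & forall x : R, is_derive x 1 U (P (U x))].
Proof.
move=> hf hP P0; have [cP P1 _ Pp _] := hP.
have [K K0 PK] := profile_le_linear hf hP.
have PC := profile_le_linear0 hf hP P0.
have [U U0 dU] := profile_flow (1 / 2) hf hP.
have cPc : continuous (P \o @clamp R 1).
  by move=> x; apply: continuous_comp; [exact: clamp_continuous|exact: cP].
have half1 : 1 / 2 < 1 :> R by lra.
have bge0 u : 0 <= (P \o @clamp R 1) u := profile_clamp_ge0 u hP.
have bgt0 u : 1 / 2 <= u < 1 -> 0 < (P \o @clamp R 1) u.
  by move=> u01 /=; rewrite clamp_id; [apply: Pp|]; lra.
have ble u : 1 / 2 <= u <= 1 -> (P \o @clamp R 1) u <= K * (1 - u).
  by move=> u01 /=; rewrite clamp_id; [apply: PK|]; lra.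
have Und := flow_nondecreasing bge0 dU.
have Ur := flow_lt1 bge0 ble half1 U0 dU.
have U1 := flow_cvg1 cPc bge0 bgt0 ble half1 U0 dU.
pose b u := (P \o @clamp R 1) (1 - u); pose W x := 1 - U (- x).
have cb : continuous b.
  have -> : b = (P \o @clamp R 1) \o (fun u => 1 - u) by [].
  move=> x; apply: continuous_comp.
    by apply: cvgB; [exact: cvg_cst|exact: cvg_id].
  exact: cPc.
have bge0' u : 0 <= b u by exact: bge0.
have bgt0' u : 1 / 2 <= u < 1 -> 0 < b u.
  by move=> u01; rewrite /b /= clamp_id; [apply: Pp|]; lra.
have ble' u : 1 / 2 <= u <= 1 -> b u <= `|c| * (1 - u).
  by move=> u01; rewrite /b /= clamp_id; [apply: PC|]; lra.
have W0 : W 0 = 1 / 2 by rewrite /W oppr0 U0; lra.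
have dW (x : R) : is_derive x 1 W (b (W x)).
  have dN : is_derive x 1 (-%R : R -> R) (- 1) by exact: is_deriveNid.
  have d1 := @is_derive1_comp R U -%R x _ _ (dU (- x)) dN.
  have d2 : is_derive x 1 W (0 - (P (clamp 1 (U (- x))) * - 1)).
    exact: is_deriveB.
  apply: (is_derive_eq d2); rewrite /b /W /=.
  by rewrite (_ : 1 - (1 - _) = U (- x)); ring.
have Wr := flow_lt1 bge0' ble' half1 W0 dW.
have W1 := flow_cvg1 cb bge0' bgt0' ble' half1 W0 dW.
have Uitv x : 0 < U x < 1.
  have [x0|/ltW x0] := leP 0 x; first by have := Ur x x0; lra.
  have := Wr (- x); rewrite oppr_ge0 => /(_ x0); rewrite /W opprK; lra.
exists U; split=> //.
- apply: from0to1P => //.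
  + by move=> x; have := Uitv x; lra.
  + by move=> e /W1[A /(_ A (lexx _))]; rewrite /W => h; exists (- A); lra.
  + by move=> e /U1[A /(_ A (lexx _))]; exists A.
- by move=> x; have := dU x; rewrite clamp_id//; have := Uitv x; lra.
Qed.

(** A profile with [P 0 = 0] joins 0 to 1 without control. At a supercritical
    speed no such wave exists, hence [P 0 > 0] there. *)
Lemma profile_traveling_wave (R : realType) (f P : R -> R) (c : R) :
  monostable f -> profile f c P -> P 0 = 0 -> exists U, traveling_wave f c U.
Proof.
move=> hf hP P0; have [U [Und U01 Uitv dU]] := profile_wave hf hP P0.
have Uitv' x : 0 <= U x < 1 by have := Uitv x; lra.
have PU x : 0 < P (U x) by case: hP => _ _ _ Pp _; exact: Pp.
have U' : U^`()%classic = P \o U.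
  by apply/funext => x; rewrite derive1E; have [_ ->] := dU x.
have dPU x := profile_slope_derive hP (Uitv' x) (PU x) (dU x).
have U'' x : U^`(2)%classic x = - c * P (U x) - f (U x).
  have -> : U^`(2)%classic x = 'D_1 (U^`()%classic) x by rewrite -derive1E.
  by rewrite U'; have [_ ->] := dPU x.
exists U; split; last exact: U01.
- by move=> x; have := Uitv x; lra.
- by move=> x; have [] := dU x.
- by move=> x; rewrite U'; have [] := dPU x.
- by move=> x; rewrite U'' U' /=; ring.
Qed.

Lemma positive_wave_cost (R : realType) (f P : R -> R) (c : R) :
  monostable f -> profile f c P -> P 0 = 0 -> costs f c 0.
Proof.
move=> hf hP P0; have [U [Und U01 Uitv dU]] := profile_wave hf hP P0.
have cf := monostable_continuous hf.
have [cP _ _ Pp _] := hP.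
have Uitv' x : 0 <= U x < 1 by have := Uitv x; lra.
have PU x : 0 < P (U x) by exact: Pp.
have dPU x := profile_slope_derive hP (Uitv' x) (PU x) (dU x).
have cU : continuous U by move=> x; exact: is_derive_continuous_at (dU x).
have cPU : continuous (P \o U) by move=> x; exact: is_derive_continuous_at (dPU x).
have [K K0 PK] := profile_le_linear hf hP.
have [M M0 fM] := monostable_le_linear hf.
exists mzero => //=; exists U; split=> //.
apply: (@measure_solution_itv _ f c M K mzero U (P \o U)) => //.
- move=> x; have Ux : 0 <= U x <= 1 by have := Uitv x; lra.
  rewrite ger0_norm ?(monostable_ge0 hf)// (le_trans (fM _ Ux))// ger_pMr//; lra.
- exact: continuous_measurable_fun.
- exact: continuous_measurable_fun.
- move=> x /=; have Ux : 0 <= U x <= 1 by have := Uitv x; lra.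
  rewrite ger0_norm ?(ltW (PU x))// (le_trans (PK _ Ux))// ger_pMr//; lra.
- by move=> x; apply: cvg_within_filter; exact: cPU.
- by move=> a b ab; rewrite (Rintegral_derive ab cU cPU (fun x _ => dU x)).
- move=> a b ab; rewrite addr0.
  rewrite (@Rintegral_derive _ (P \o U) _ _ _ ab cPU _ (fun x _ => dPU x))//.
  move=> x; apply: cvgB; first by apply: cvgM; [exact: cvg_cst|exact: cPU].
  by apply: continuous_comp; [exact: cU|exact: cf].
Qed.

(** The wave is 0 up to the origin, where a Dirac mass raises its slope from 0 to
    [P 0], and then it solves [U' = P(U)]. *)
Lemma positive_profile_cost (R : realType) (f P : R -> R) (c : R) :
  monostable f -> profile f c P -> 0 < P 0 -> costs f c (P 0).
Proof.
move=> hf hP P0; have [cP P1 _ Pp _] := hP.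
have cf := monostable_continuous hf.
have [_ f0 _ _] := hf.
have [K K0 PK] := profile_le_linear hf hP.
have [M M0 fM] := monostable_le_linear hf.
have [W W0 dW] := profile_flow 0 hf hP.
have cPc : continuous (P \o @clamp R 1).
  by move=> x; apply: continuous_comp; [exact: clamp_continuous|exact: cP].
have bge0 u : 0 <= (P \o @clamp R 1) u := profile_clamp_ge0 u hP.
have bgt0 u : 0 <= u < 1 -> 0 < (P \o @clamp R 1) u.
  move=> u01 /=; rewrite clamp_id; last by lra.
  by have [->//|un0] := eqVneq u 0; apply: Pp; rewrite lt_neqAle eq_sym un0.
have ble u : 0 <= u <= 1 -> (P \o @clamp R 1) u <= K * (1 - u).
  by move=> u01 /=; rewrite clamp_id; [apply: PK|]; lra.
have lt01 : (0 : R) < 1 by [].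
have Wnd := flow_nondecreasing bge0 dW.
have Wr := flow_lt1 bge0 ble lt01 W0 dW.
have W1 := flow_cvg1 cPc bge0 bgt0 ble lt01 W0 dW.
have cW : continuous W by move=> x; exact: is_derive_continuous_at (dW x).
pose U x := W (Num.max 0 x).
have max0 (x : R) : 0 <= Num.max 0 x by rewrite le_max lexx.
have Uitv x : 0 <= U x < 1 by exact: Wr.
have Und : {homo U : x y / x <= y}.
  by move=> x y xy; apply: Wnd; rewrite ge_max max0/= le_max xy orbT.
have PU x : 0 < P (U x).
  by have := bgt0 _ (Uitv x); rewrite /= clamp_id//; have := Uitv x; lra.
have PUK x : P (U x) <= K.
  by apply: le_trans (PK (U x) _) _; rewrite ?ger_pMr//; have := Uitv x; lra.
pose Q := P \o W.
have cQ : continuous Q by move=> x; apply: continuous_comp; [exact: cW|exact: cP].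
have QU x : 0 <= x -> Q x = P (U x) by move=> x0; rewrite /Q /U max_r.
pose V x := (0 <= x)%R%:R * P (U x).
have Vp x : 0 <= x -> V x = P (U x) by rewrite /V => ->; rewrite mul1r.
have Vn x : x < 0 -> V x = 0 by rewrite /V leNgt => ->; rewrite mul0r.
have Un x : x <= 0 -> U x = 0 by move=> x0; rewrite /U max_l.
have VE x : V x = P (U x) - P 0 * (x < 0)%R%:R.
  have [x0|x0] := ltP x 0; last by rewrite Vp// mulr0 subr0.
  by rewrite Vn// Un ?(ltW x0)// mulr1 subrr.
have UM x : U (Num.max 0 x) = U x by rewrite /U maxA maxxx.
have cmax : continuous (fun x : R => Num.max 0 x).
  by move=> x; apply: continuous_max; [exact: cvg_cst|exact: cvg_id].
have cU : continuous U by move=> x; apply: continuous_comp; [exact: cmax|exact: cW].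
have cPU : continuous (P \o U) by move=> x; apply: continuous_comp; [exact: cU|exact: cP].
have mV : measurable_fun setT V.
  apply: measurable_funM; last exact: continuous_measurable_fun.
  apply: nondecreasing_measurable => // x y xy; rewrite ler_nat.
  by case: (leP 0 x) => // x0; rewrite (le_trans x0).
have VK x : `|V x| <= K.
  have [x0|x0] := leP 0 x; last by rewrite Vn// normr0 ltW.
  by rewrite Vp// gtr0_norm.
have fUM x : `|f (U x)| <= M.
  have Ux : 0 <= U x <= 1 by have := Uitv x; lra.
  rewrite ger0_norm ?(monostable_ge0 hf)// (le_trans (fM _ Ux))// ger_pMr//; lra.
have dW' (x : R) : 0 <= x -> is_derive x 1 W (Q x).
  by move=> x0; have := dW x; rewrite clamp_id//; have := Wr x x0; lra.
have dQ (x : R) : 0 < x -> is_derive x 1 Q (- c * Q x - f (W x)).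
  move=> x0; apply: (profile_slope_derive hP); first exact/Wr/ltW.
    by rewrite -[P _]/(Q x) QU// ltW.
  exact/dW'/ltW.
pose mu : {finite_measure set (measurableTypeR R) -> \bar R} :=
  mscale (NngNum (ltW P0)) (dirac (0 : measurableTypeR R)).
have muE (A : set (measurableTypeR R)) : fine (mu A) = P 0 * (0 \in A)%:R.
  have -> : mu A = ((P 0)%:E * @dirac _ (measurableTypeR R) 0%R R A)%E by [].
  by rewrite diracE -EFinM.
exists mu; last by rewrite muE in_setT mulr1.
exists U; split=> //.
  apply: from0to1P => //.
  - by move=> x; have := Uitv x; lra.
  - by move=> e e0; exists 0; rewrite Un// ltW.
  - by move=> e /W1[A HA]; exists A; apply: HA; rewrite le_max lexx orbT.
apply: (@measure_solution_itv _ f c M K mu U V) => //.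
- exact: continuous_measurable_fun.
- move=> x; have [x0|x0] := leP 0 x.
    have h : (P \o U) @ at_right x --> P (U x) by apply: cvg_within_filter; exact: cPU.
    rewrite Vp//; apply: cvg_trans h; apply: near_eq_cvg; near=> y.
    have xy : x < y by near: y; exact: nbhs_right_gt.
    by rewrite Vp// (le_trans x0)// ltW.
  have h : (fun _ : R => 0 : R) @ at_right x --> (0 : R) by exact: cvg_cst.
  rewrite Vn//; apply: cvg_trans h; apply: near_eq_cvg; near=> y.
  by rewrite Vn//; near: y; exact: nbhs_right_lt.
- move=> a b ab.
  rewrite (Rintegral_derive_cut ab cW cQ (fun x x0 => dW' x (ltW x0)) mV VK)//.
  by move=> x x0; rewrite Vp// QU.
- have cQ' : continuous (fun x => - c * Q x - f (W x)).
    move=> x; apply: cvgB; first by apply: cvgM; [exact: cvg_cst|exact: cQ].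
    by apply: continuous_comp; [exact: cW|exact: cf].
  have mV' : measurable_fun setT (fun x => - c * V x - f (U x)).
    apply: measurable_funB.
      by apply: measurable_funM => //; exact: measurable_cst.
    by apply: continuous_measurable_fun => x; apply: continuous_comp; [exact: cU|exact: cf].
  have V'K x : `|- c * V x - f (U x)| <= `|c| * K + M.
    rewrite (le_trans (ler_normB _ _))// lerD//.
    by rewrite normrM normrN ler_wpM2l.
  move=> a b ab; rewrite (Rintegral_derive_cut ab cQ cQ' dQ mV' V'K)//.
  + rewrite !QU// muE !UM !VE.
    have -> : (0 \in `]a, b]%classic) = (a < 0 <= b).
      by apply/idP/idP; rewrite inE /= in_itv.
    by have [a0|a0] := ltP a 0; have [b0|b0] := leP 0 b => /=; lra.
  + by move=> x x0; rewrite Vp// QU// /U max_r.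
  + by move=> x x0; rewrite Vn// Un ?(ltW x0)// f0 mulr0 subr0.
Unshelve. all: by end_near. Qed.

(** * The minimum cost as a function of the speed *)

(** Lower bound and attainment together; from here on, the speed acts only
    through the profile. *)
Lemma min_cost_profile (R : realType) (f P : R -> R) (c : R) :
    monostable f -> profile f c P ->
  [/\ costs f c (P 0), lbound (costs f c) (P 0) & min_cost f c = P 0].
Proof.
move=> hf hP.
have att : costs f c (P 0).
  have [_ _ P0 _ _] := hP.
  have [Pz|Pn] := eqVneq (P 0) 0; first by rewrite Pz; exact: positive_wave_cost Pz.
  by apply: positive_profile_cost; rewrite // lt_neqAle eq_sym Pn.
have lb : lbound (costs f c) (P 0).
  by move=> _ [mu mua <-]; exact: admissible_ge_profile mua.
split=> //; apply/le_anti/andP; split.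
  by apply: ge_inf => //; exists (P 0).
by apply: lb_le_inf => //; exists (P 0).
Qed.

(** [P2] is a supersolution for the smaller speed [c1], hence [P1 <= P2]. If
    both agreed at 0 with a positive value, both would be differentiable there
    and [P2 - P1] would have the derivative [c1 - c2 < 0]. *)
Lemma profile_lt (R : realType) (f P1 P2 : R -> R) (c1 c2 : R) :
    monostable f -> profile f c1 P1 -> profile f c2 P2 -> c1 < c2 ->
  0 < P2 0 -> P1 0 < P2 0.
Proof.
move=> hf hP1 hP2 c12 P20.
have [cP1 _ P10 P1p dP1] := hP1; have [cP2 P21 _ P2p dP2] := hP2.
have P12 : forall u, 0 <= u <= 1 -> P1 u <= P2 u.
  apply: (profile_le (Q := P2) (dQ := fun u => - c2 - f u / P2 u) hf hP1) => //.
  - by rewrite P21.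
  - by move=> u u01; apply: dP2; [lra|exact: P2p].
  - by move=> u _; lra.
rewrite lt_neqAle P12 ?lexx ?ler01// andbT; apply/eqP => P0E.
have P1_gt0 : 0 < P1 0 by rewrite P0E.
have z01 : (0 <= 0 :> R) && (0 < 1 :> R) by rewrite lexx ltr01.
have [_ f0 _ _] := hf.
have d1 := dP1 0 z01 P1_gt0; have d2 := dP2 0 z01 P20.
have d : is_derive (0 : R) 1 (P2 - P1) (c1 - c2).
  by apply: (is_derive_eq (is_deriveB d2 d1)); rewrite f0 !mul0r; ring.
have e0 : 0 < (c2 - c1) / 2 by rewrite divr_gt0// subr_gt0.
have [r r0 Hr] := derive_estimate d e0.
pose h := Num.min r 1; have h0 : 0 < h by rewrite lt_min r0 ltr01.
have hr : h <= r by rewrite ge_min lexx.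
have h1 : h <= 1 by rewrite ge_min lexx orbT.
have := Hr h; rewrite (gtr0_norm h0) add0r => /(_ hr).
rewrite -[(P2 - P1) h]/(P2 h - P1 h) -[(P2 - P1) 0]/(P2 0 - P1 0) P0E subrr subr0.
have : P1 h <= P2 h by apply: P12; rewrite ltW.
have : 0 < (c2 - c1) * h by rewrite mulr_gt0// subr_gt0.
by rewrite ler_norml; lra.
Qed.

Lemma inv_convex (R : realFieldType) (t s a b : R) :
  0 <= t -> 0 <= s -> t + s = 1 -> 0 < a -> 0 < b ->
  (t * a + s * b)^-1 <= t / a + s / b.
Proof.
move=> t0 s0 ts a0 b0; have sE : s = 1 - t by rewrite -ts; ring.
have q0 : 0 < t * a + s * b.
  have [t0'|tn] := eqVneq t 0; first by rewrite sE t0' subr0 mul0r add0r mul1r.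
  by rewrite ltr_pwDl ?mulr_ge0 ?(ltW b0)// mulr_gt0// lt_neqAle eq_sym tn.
have := q0; rewrite sE => q0'.
rewrite -subr_ge0.
have -> : t / a + (1 - t) / b - (t * a + (1 - t) * b)^-1 =
    t * (1 - t) * (a - b) ^+ 2 / (a * b * (t * a + (1 - t) * b)).
  by field; rewrite !gt_eqF.
rewrite -sE; apply: divr_ge0; first by rewrite mulr_ge0 ?sqr_ge0// mulr_ge0.
by apply: mulr_ge0; [rewrite mulr_ge0 ?ltW|exact: ltW].
Qed.

(** The combination of the two profiles is a supersolution for the combined
    speed, because inversion is convex. *)
Lemma profile_convex (R : realType) (f P P1 P2 : R -> R) (c1 c2 t s : R) :
    monostable f -> profile f c1 P1 -> profile f c2 P2 ->
    0 <= t -> 0 <= s -> t + s = 1 -> profile f (t * c1 + s * c2) P ->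
  P 0 <= t * P1 0 + s * P2 0.
Proof.
move=> hf [cP1 P11 _ P1p dP1] [cP2 P21 _ P2p dP2] t0 s0 ts hP.
have z01 : (0 <= 0 :> R) && (0 <= 1 :> R) by rewrite lexx ler01.
apply: (profile_le (Q := fun u => t * P1 u + s * P2 u)
  (dQ := fun u => t * (- c1 - f u / P1 u) + s * (- c2 - f u / P2 u)) hf hP) z01.
- move=> u; apply: cvgD; apply: cvgM; [exact: cvg_cst|exact: cP1|exact: cvg_cst|exact: cP2].
- by rewrite P11 P21 !mulr0 addr0.
- move=> u u01; rewrite -invr_gt0.
  have := P1p u u01; have := P2p u u01 => p2 p1.
  have [t0'|tn] := eqVneq t 0.
    have s1 : s = 1 by rewrite -ts t0' add0r.
    by rewrite t0' s1 mul0r add0r mul1r invr_gt0.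
  by rewrite invr_gt0 ltr_pwDl ?mulr_ge0 ?(ltW p2)// mulr_gt0// lt_neqAle eq_sym tn.
- move=> u u01; have u01' : 0 <= u < 1 by lra.
  have d1 : is_derive u 1 (t \*: P1) (t *: (- c1 - f u / P1 u)).
    by apply: is_deriveZ; exact: dP1 u01' (P1p _ u01).
  have d2 : is_derive u 1 (s \*: P2) (s *: (- c2 - f u / P2 u)).
    by apply: is_deriveZ; exact: dP2 u01' (P2p _ u01).
  exact: is_deriveD d1 d2.
- move=> u u01; have fu := monostable_gt0 hf u01.
  have := inv_convex t0 s0 ts (P1p u u01) (P2p u u01).
  by move=> /(ler_wpM2l (ltW fu)); lra.
Qed.

Theorem proposition5p3 (R : realType) (f : R -> R) (cs : R)
    (hf : monostable f) (hcs : critical_speed f cs) :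
  [/\ forall c : R, cs <= c ->
        costs f c (min_cost f c) /\ lbound (costs f c) (min_cost f c),
      {in `[cs, +oo[ &, {homo min_cost f : c1 c2 / c1 < c2}}
    & convex_function (E := R^o) [set` `[cs, +oo[] (min_cost f)].
Proof.
split.
- move=> c _; have [P hP] := profile_exists c hf.
  by have [? ? ->] := min_cost_profile hf hP.
- move=> c1 c2; rewrite !in_itv/= !andbT => cs1 cs2 c12.
  have [P1 hP1] := profile_exists c1 hf; have [P2 hP2] := profile_exists c2 hf.
  have [_ _ ->] := min_cost_profile hf hP1.
  have [_ _ ->] := min_cost_profile hf hP2.
  apply: (profile_lt hf hP1 hP2 c12).
  have [_ _ P20 _ _] := hP2; rewrite lt_neqAle P20 andbT; apply/eqP => P2z.
  have [_ _ noW] := hcs; apply: (noW c2); first exact: le_lt_trans c12.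
  exact: (profile_traveling_wave hf hP2).
- move=> t c1 c2 _ _.
  have [P1 hP1] := profile_exists (c1 : R) hf; have [P2 hP2] := profile_exists (c2 : R) hf.
  have t0 : 0 <= t%:num by [].
  have s0 : 0 <= 1 - t%:num by rewrite subr_ge0.
  have ts : t%:num + (1 - t%:num) = 1 by rewrite addrC subrK.
  have [P hP] := profile_exists (t%:num * c1 + (1 - t%:num) * c2) hf.
  have [_ _ E1] := min_cost_profile hf hP1.
  have [_ _ E2] := min_cost_profile hf hP2.
  have [_ _ E] := min_cost_profile hf hP.
  have := profile_convex hf hP1 hP2 t0 s0 ts hP.
  by rewrite -E1 -E2 -E.
Qed.
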